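(* A pair of partitions $(\mu,\nu)$ is NL-multiplicity-free if and only if at least one of the following holds: (I) $\mu$ or $\nu$ is either a single box or $\emptyset$; (II) $\mu$ is a single row and $\nu$ is a rectangle (or vice versa); (III) $\mu$ is a single column and $\nu$ is a rectangle (or vice versa).
   Context: With $c_{\alpha,\beta}^{\mu}$ the Littlewood-Richardson coefficient ($s_\alpha s_\beta=\sum_\mu c_{\alpha,\beta}^\mu s_\mu$), the Newell-Littlewood number is $$N_{\mu,\nu,\lambda}=\sum_{\alpha,\beta,\gamma} c_{\alpha,\beta}^{\mu}c_{\alpha,\gamma}^{\nu}c_{\beta,\gamma}^{\lambda},$$ the sum over all triples of partitions (finitely many nonzero terms). A pair of partitions $(\mu,\nu)$ is NL-multiplicity-free if $N_{\mu,\nu,\lambda}\in\{0,1\}$ for every partition $\lambda$. A single box is the partition $(1)$, a single row is a partition $(k)$, a single column is a partition $(1^k)$, and a rectangle is a partition $(c^d)$ with $d$ parts all equal to $c$. *)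

(* Defs.v *)
From HB Require Import structures.
From mathcomp Require Import all_boot all_order all_algebra.
From mathcomp Require Import mpoly.
From mathcomp Require Import boolp classical_sets cardinality fsbigop.

Set Implicit Arguments.
Unset Strict Implicit.
Unset Printing Implicit Defensive.

Import Order.TTheory GRing.Theory Num.Theory.

Local Open Scope classical_set_scope.
Local Open Scope ring_scope.

Definition is_partition (s : seq nat) : bool :=
  sorted geq s && (0%N \notin s).

Record intpart : Type :=
  IntPart { parts :> seq nat; _ : is_partition parts }.

HB.instance Definition _ := [isSub for parts].
HB.instance Definition _ := [Countable of intpart by <:].

(* Boxes of the Young diagram, as (row, column) pairs numbered from 0. *)
Definition box (la : intpart) : finType :=
  {i : 'I_(size la) & 'I_(nth 0%N la i)}.

Definition box_row (la : intpart) (b : box la) : nat := tag b.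
Definition box_col (la : intpart) (b : box la) : nat := tagged b.

Definition semistandard (la : intpart) (n : nat)
    (T : {ffun box la -> 'I_n}) : bool :=
  [forall b, forall b',
     ((box_row b == box_row b') && (box_col b < box_col b')%N
        ==> (T b <= T b')%N)
     && ((box_col b == box_col b') && (box_row b < box_row b')%N
        ==> (T b < T b')%N)].

Definition schur (n : nat) (la : intpart) : {mpoly int[n]} :=
  \sum_(T : {ffun box la -> 'I_n} | semistandard T) \prod_(b : box la) 'X_(T b).

(* An element of the ring of symmetric functions is identified with its family
   of specializations to n variables, n : nat.  The Schur functions form a
   basis of that ring, so for given al and be exactly one c satisfies
   [schur_expansion al be c]. *)
Definition schur_expansion (al be : intpart) (c : intpart -> int) : Prop :=
  finite_set [set mu | c mu != 0] /\
  forall n : nat,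
    schur n al * schur n be = \sum_(mu \in [set: intpart]) c mu *: schur n mu.

(* [LR al be mu] is the coefficient of s_mu in s_al * s_be. *)
Definition LR (al be : intpart) : intpart -> int :=
  xget (fun=> 0) [set c | schur_expansion al be c].

(* Only finitely many terms are nonzero, because LR al be mu = 0 unless
   the diagrams of al and be are both contained in that of mu. *)
Definition NL (mu nu la : intpart) : int :=
  \sum_(t \in [set: intpart * intpart * intpart])
    let: (al, be, ga) := t in LR al be mu * LR al ga nu * LR be ga la.

Definition NL_multiplicity_free (mu nu : intpart) : Prop :=
  forall la : intpart, NL mu nu la = 0 \/ NL mu nu la = 1.

Definition is_empty (la : intpart) : Prop := parts la = [::].

Definition is_single_box (la : intpart) : Prop := parts la = [:: 1%N].

Definition is_single_row (la : intpart) : Prop :=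
  exists k : nat, parts la = [:: k].

Definition is_single_column (la : intpart) : Prop :=
  exists k : nat, parts la = nseq k 1%N.

Definition is_rectangle (la : intpart) : Prop :=
  exists c d : nat, parts la = nseq d c.

(* Main.v *)
From mathcomp Require Import all_boot all_order all_algebra all_fingroup.
From mathcomp Require Import zify.
From mathcomp Require Import mpoly.
From mathcomp Require Import boolp classical_sets cardinality fsbigop.
Require Import Defs.

Set Implicit Arguments.
Unset Strict Implicit.
Unset Printing Implicit Defensive.

Import Order.TTheory GRing.Theory Num.Theory.

(** The Littlewood-Richardson coefficients are first identified with numbers of
    tableaux, by Stembridge's argument.  For a partition [la] and a semistandard
    tableau [T] of shape [mu], the alternant with exponents [la + rho] times the
    Schur polynomial of [mu] is the sum over [T] of the alternants with exponents
    [la + content T + rho], because Schur polynomials are symmetric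
    ([schur_sym]).  If adding to [la] the columns of [T] one by one from the
    right meets a sequence that is not a partition, then at the first such
    column, in the first possible row, the defect is one, and the Bender-Knuth
    involution [bk] on the columns further left transposes two exponents: these
    terms cancel ([violation_cancel]).  For empty [la] only the superstandard tableau
    remains, which gives the bialternant formula ([schur_bialternant]); dividing
    by the alternant of [rho] gives the Littlewood-Richardson rule [schur_mul],
    and comparing coefficients gives [LR_count].  In particular the coefficients
    are nonnegative, so that one or two nonzero terms bound a Newell-Littlewood
    number from below ([NL_ge]).

    If [mu] is a row or a column, a tableau whose shape is contained in [mu] is
    determined by its content, so all coefficients involved are 0 or 1; the
    sizes of [al] and [be] are forced by those of [mu], [nu] and [la], and
    [ga] is [nu] minus a horizontal or vertical strip of given size, which is
    unique when [nu] is a rectangle ([strip_rectangle_uniq]).  The same works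
    for arbitrary [nu] if [mu] has at most one box ([small_free]).

    Conversely let [mu] and [nu] both have at least two boxes, and take for [al]
    a single box.  If [mu] is not a rectangle it has two corners, so [be] can be
    chosen in two ways; a suitable [la] occurs in the product of the Schur
    functions of [be] and [ga] for both of them ([LR_corner]).  If [mu] and [nu]
    are rectangles with at least two rows and two columns, then [be] and [ga]
    are rectangles without their last boxes, and a single coefficient of the
    product of their Schur functions is already at least 2, as for the
    coefficient of [(3, 2, 1)] in the square of the Schur function of [(2, 1)]
    ([LR_rectangles_ge2]). *)


(** * Partitions as weakly decreasing functions *)

(** The length of row [i], zero below the diagram. *)
Definition rowlen (la : intpart) (i : nat) : nat := nth 0 la i.

(** The number of boxes. *)
Definition psize (la : intpart) : nat := sumn la.

Lemma rowlen_anti (la : intpart) i j : i <= j -> rowlen la j <= rowlen la i.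
Proof.
move=> lij; rewrite /rowlen.
have /andP[srt _] : is_partition la by case: la.
case: (ltnP j (size la)) => [lj|gj]; last by rewrite (nth_default _ gj).
apply: (sorted_leq_nth (leT := geq)) => //.
- by move=> x y z /= h1 h2; apply: leq_trans h2 h1.
- by move=> x /=.
- by rewrite inE; apply: leq_ltn_trans lj.
Qed.

Lemma rowlen_gt0 (la : intpart) i : (0 < rowlen la i) = (i < size la).
Proof.
rewrite /rowlen; have /andP[_ n0] : is_partition la by case: la.
case: (ltnP i (size la)) => [li|gi]; last by rewrite nth_default.
by rewrite lt0n; apply: contraNneq n0 => <-; rewrite mem_nth.
Qed.

Lemma rowlen_default (la : intpart) i : size la <= i -> rowlen la i = 0.
Proof. by move=> h; rewrite /rowlen nth_default. Qed.

Lemma rowlen_inj (la mu : intpart) : rowlen la =1 rowlen mu -> la = mu.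
Proof.
move=> e; have es : size la = size mu.
  apply/eqP; rewrite eqn_leq.
  apply/andP; split; rewrite leqNgt -rowlen_gt0.
  - by rewrite e rowlen_gt0 ltnn.
  - by rewrite -e rowlen_gt0 ltnn.
apply: val_inj; apply: (@eq_from_nth _ 0) => // i _; exact: e.
Qed.

Lemma psizeE (la : intpart) N : size la <= N -> psize la = \sum_(i < N) rowlen la i.
Proof.
move=> h; rewrite /psize sumnE (big_nth 0) big_mkord.
rewrite (big_ord_widen N (fun i => nth 0 la i) h) big_mkcond /=.
apply: eq_bigr => i _; case: ifP => // /negbT; rewrite -leqNgt => g.
by rewrite rowlen_default.
Qed.

Lemma size_leq_psize (la : intpart) : size la <= psize la.
Proof.
rewrite (psizeE (leqnn _)) -[X in X <= _]card_ord -sum1_card leq_sum // => i _.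
by rewrite rowlen_gt0.
Qed.

Lemma rowlen_leq_psize (la : intpart) i : rowlen la i <= psize la.
Proof.
case: (ltnP i (size la)) => h; last by rewrite rowlen_default.
by rewrite (psizeE (leqnn _)) (bigD1 (Ordinal h)) //= leq_addr.
Qed.

Lemma empty_is_partition : is_partition [::]. Proof. by []. Qed.

(** The partition without rows. *)
Definition empty_part : intpart := IntPart empty_is_partition.

(** The partition with rows [f 0, ..., f (N - 1)] when these are weakly
    decreasing; the empty partition is a default value otherwise. *)
Definition of_rows (N : nat) (f : nat -> nat) : intpart :=
  insubd empty_part [seq x <- mkseq f N | x != 0].

Lemma rowlen_of_rows N f : (forall i, f i.+1 <= f i) ->
  (forall i, N <= i -> f i = 0) -> rowlen (of_rows N f) =1 f.
Proof.
move=> fd f0 i; have fm a b : a <= b -> f b <= f a.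
  elim: b => [|b IH]; first by rewrite leqn0 => /eqP ->.
  rewrite leq_eqVlt => /orP[/eqP -> //|h]; exact: leq_trans (fd b) (IH h).
have srt : sorted geq (mkseq f N).
  by apply: (homo_sorted (e := leq)) (iota_sorted 0 N) => a b /fm.
have trg : transitive geq by move=> x y z /= h1 h2; apply: leq_trans h2 h1.
have pt : is_partition [seq x <- mkseq f N | x != 0].
  by rewrite /is_partition (sorted_filter trg) // mem_filter.
rewrite /rowlen /of_rows /insubd insubT /=.
elim: N f i fd f0 fm {srt pt} => [|N IH] f i fd f0 fm.
  by rewrite nth_default // f0.
rewrite /mkseq /= -/(iota _ _) -[1]addn0 iotaDl -map_comp.
have IH' j : nth 0 [seq x <- mkseq (fun k => f k.+1) N | x != 0] j = f j.+1.
  by apply: (IH (fun k => f k.+1)) => // [k h|a b h]; [rewrite f0 | apply: fm].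
case: ifP => [_|/negbFE /eqP f00]; first by case: i => [|i] //=; exact: IH'.
have fz k : f k = 0 by apply/eqP; rewrite -leqn0 -f00 fm.
rewrite fz.
rewrite (@eq_in_filter _ _ pred0) ?filter_pred0 ?nth_nil //.
by move=> x /mapP[k _ ->] /=; rewrite fz.
Qed.

Lemma finite_psize M : finite_set [set la | psize la <= M]%classic.
Proof.
pose F (g : {ffun 'I_M -> 'I_M.+1}) : intpart :=
  of_rows M (fun i => if insub i is Some j then nat_of_ord (g j) else 0).
apply: (@sub_finite_set _ _ (F @` setT)%classic); last first.
  by apply: finite_image; exact: finite_finset.
move=> la /= h.
pose g : {ffun 'I_M -> 'I_M.+1} := [ffun i : 'I_M => inord (rowlen la i)].
exists g => //.
have e i : (if insub i is Some j then nat_of_ord (g j) else 0) = rowlen la i.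
  case: insubP => [j _ ej|]; last first.
    rewrite -leqNgt => gi; rewrite rowlen_default //.
    by apply: leq_trans gi; apply: leq_trans h; exact: size_leq_psize.
  by rewrite ffunE inordK ej // ltnS; exact: leq_trans (rowlen_leq_psize _ _) h.
apply: rowlen_inj => i; rewrite rowlen_of_rows ?e // => [j|j hj].
  by rewrite !e rowlen_anti.
rewrite e rowlen_default //.
by apply: leq_trans hj; apply: leq_trans h; exact: size_leq_psize.
Qed.

(** * Semistandard tableaux *)

Lemma box_rowP (la : intpart) (b : box la) : box_row b < size la.
Proof. exact: ltn_ord. Qed.

Lemma box_colP (la : intpart) (b : box la) : box_col b < rowlen la (box_row b).
Proof. exact: ltn_ord. Qed.

Lemma box_ex (la : intpart) i c : c < rowlen la i ->
  exists b : box la, box_row b = i /\ box_col b = c.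
Proof.
move=> h; have hi : i < size la by rewrite -rowlen_gt0; case: rowlen h.
by exists (@Tagged _ (Ordinal hi) (fun i => 'I_(nth 0 la i)) (Ordinal h)).
Qed.

Lemma box_inj (la : intpart) (b b' : box la) :
  box_row b = box_row b' -> box_col b = box_col b' -> b = b'.
Proof.
case: b b' => [i c] [i' c']; rewrite /box_row /box_col /= => /val_inj ei.
by move: c'; case: i' / ei => c' /= /val_inj ->.
Qed.

Lemma sum_boxE (la : intpart) (F : nat -> nat -> nat) :
  \sum_(b : box la) F (box_row b) (box_col b) =
  \sum_(i < size la) \sum_(c < rowlen la i) F i c.
Proof.
by rewrite (@sig_big_dep _ 0 addn _ (fun i : 'I_(size la) => 'I_(nth 0 la i))
  xpredT (fun _ => xpredT) (fun i c => F i c)).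
Qed.

Lemma card_box (la : intpart) : #|{: box la}| = psize la.
Proof.
rewrite -sum1_card (psizeE (leqnn _)) (sum_boxE la (fun _ _ => 1)).
by apply: eq_bigr => i _; rewrite sum1_card card_ord.
Qed.

(** A decreasing boolean predicate holds exactly below its count. *)
Lemma count_initial (p : nat -> bool) j c :
  (forall a b, a <= b -> p b -> p a) -> c < j ->
  p c = (c < \sum_(d < j) p d).
Proof.
move=> pd; elim: j c => [//|j IH] c; rewrite ltnS leq_eqVlt big_ord_recr /=.
have le k : \sum_(d < k) p d <= k.
  by rewrite -[X in _ <= X]card_ord -sum1_card leq_sum // => d _; case: (p d).
case/orP => [/eqP ->|cj].
  case: (boolP (p j)) => pj; last by rewrite addn0 ltnNge le.
  rewrite addn1 ltnS -[X in X <= _]card_ord -sum1_card leq_sum // => d _.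
  by rewrite (pd d j) // ltnW.
case: (boolP (p j)) => pj; last by rewrite addn0; exact: IH.
rewrite (pd c j) // 1?ltnW // addn1 ltnS.
by apply: (leq_trans (n := c.+1)) => //; rewrite -(IH _ cj) (pd c j) // ltnW.
Qed.

Section Tableaux.

Variables (la : intpart) (n : nat).
Implicit Types (T : {ffun box la -> 'I_n}) (b : box la).

Lemma semistandardP T : reflect
  (forall b b', (box_row b = box_row b' -> box_col b < box_col b' -> T b <= T b')
    /\ (box_col b = box_col b' -> box_row b < box_row b' -> T b < T b'))
  (semistandard T).
Proof.
apply: (iffP forallP) => [h b b'|h b].
  have /forallP/(_ b')/andP[/implyP h1 /implyP h2] := h b.
  by split=> e l; [apply: h1 | apply: h2]; rewrite e eqxx.
apply/forallP => b'; have [h1 h2] := h b b'.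
apply/andP; split; apply/implyP => /andP[/eqP e l]; [exact: h1 | exact: h2].
Qed.

(** The entry in row [i] and column [c]; it is [n], larger than all entries,
    outside of the diagram. *)
Definition entry T i c : nat :=
  if [pick b | (box_row b == i) && (box_col b == c)] is Some b then T b else n.

Lemma entry_box T b : entry T (box_row b) (box_col b) = T b.
Proof.
rewrite /entry; case: pickP => [b' /andP[/eqP h1 /eqP h2]|/(_ b)].
  by rewrite (box_inj h1 h2).
by rewrite !eqxx.
Qed.

Lemma entry_out T i c : rowlen la i <= c -> entry T i c = n.
Proof.
move=> h; rewrite /entry; case: pickP => // b /andP[/eqP h1 /eqP h2].
by have := box_colP b; rewrite h1 h2 ltnNge h.
Qed.

Lemma entry_lt T i c : (entry T i c < n) = (c < rowlen la i).
Proof.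
case: (ltnP c (rowlen la i)) => [h|h]; last by rewrite entry_out // ltnn.
by have [b [<- <-]] := box_ex h; rewrite entry_box ltn_ord.
Qed.

Lemma entry_le T i c : entry T i c <= n.
Proof.
case: (ltnP c (rowlen la i)) => [h|h]; last by rewrite entry_out.
by rewrite ltnW // entry_lt.
Qed.

Lemma entry_row T i c c' : semistandard T -> c <= c' ->
  entry T i c <= entry T i c'.
Proof.
move=> /semistandardP ss; rewrite leq_eqVlt => /orP[/eqP -> //|h].
case: (ltnP c' (rowlen la i)) => h'; last by rewrite (entry_out _ h') entry_le.
have [b [eb eb']] := box_ex (ltn_trans h h').
have [d [ed ed']] := box_ex h'.
rewrite -eb -eb' entry_box eb -ed -ed' entry_box.
by apply: (ss b d).1; rewrite ?eb ?eb' ?ed ?ed'.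
Qed.

Lemma entry_col T i i' c : semistandard T -> i < i' -> entry T i' c < n ->
  entry T i c < entry T i' c.
Proof.
move=> /semistandardP ss h; rewrite entry_lt => h'.
have [b [eb eb']] := box_ex (leq_trans h' (rowlen_anti la (ltnW h))).
have [d [ed ed']] := box_ex h'.
rewrite -eb -eb' entry_box eb' -ed -ed' entry_box.
by apply: (ss b d).2; rewrite ?eb ?eb' ?ed ?ed'.
Qed.

Lemma entry_ge_row T i c : semistandard T -> i <= entry T i c \/ rowlen la i <= c.
Proof.
move=> ss; case: (ltnP c (rowlen la i)) => h; [left | by right].
elim: i h => [//|i IH] h.
have hi := leq_trans h (rowlen_anti la (leqnSn i)).
by apply: leq_ltn_trans (IH hi) _; apply: entry_col; rewrite // entry_lt.
Qed.

(** The number of occurrences of [v] in the columns [j], [j + 1], ... *)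
Definition content T (j v : nat) : nat :=
  \sum_(b : box la) ((j <= box_col b) && (T b == v :> nat)).

Lemma content_out T j v : n <= v -> content T j v = 0.
Proof.
move=> h; apply: big1 => b _; case: eqP => [e|]; rewrite ?andbF //.
by move: (ltn_ord (T b)); rewrite e ltnNge h.
Qed.

Lemma content_right T j v : rowlen la 0 <= j -> content T j v = 0.
Proof.
move=> h; apply: big1 => b _; rewrite leqNgt.
by rewrite (leq_trans (box_colP b)) // (leq_trans _ h) // rowlen_anti.
Qed.

Lemma contentE T j v M : rowlen la 0 <= M -> v < n -> content T j v =
  \sum_(i < size la) \sum_(c < M) ((j <= c) && (entry T i c == v)).
Proof.
move=> hM hv; rewrite /content.
under eq_bigr => b _ do rewrite -entry_box.
rewrite (sum_boxE la (fun i c => (j <= c) && (entry T i c == v)));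
  apply: eq_bigr => i _.
have hi : rowlen la i <= M by apply: leq_trans hM; rewrite rowlen_anti.
rewrite (big_ord_widen M (fun c => nat_of_bool ((j <= c) && (entry T i c == v))) hi).
rewrite big_mkcond; apply: eq_bigr => c _; case: ltnP => // h.
by rewrite entry_out // gtn_eqF // andbF.
Qed.

(** One column contributes at most one occurrence of [v]. *)
Lemma content_step T j v : semistandard T ->
  content T j v =
    content T j.+1 v + [exists b, (box_col b == j) && (T b == v :> nat)].
Proof.
move=> /semistandardP ss; rewrite /content.
have -> : \sum_b ((j <= box_col b) && (T b == v :> nat)) =
   \sum_b ((j < box_col b) && (T b == v :> nat)) +
   \sum_b ((box_col b == j) && (T b == v :> nat)).
  rewrite -big_split; apply: eq_bigr => b _.
  by case: (T b == v :> nat); rewrite ?andbT ?andbF //=; lia.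
congr addn; case: existsP => [[b hb]|h]; last first.
  by apply: big1 => b _; case: andP => // /andP hb; case: h; exists b.
rewrite (bigD1 b) //= hb big1 // => d db; case: andP => // -[/eqP d1 /eqP d2].
move/andP: hb => [/eqP h1 /eqP h2]; case/eqP: db; apply: box_inj; last by rewrite d1.
case: (ltngtP (box_row d) (box_row b)) => // hlt.
  by have := (ss d b).2; rewrite d1 h1 d2 h2 ltnn => /(_ erefl hlt).
by have := (ss b d).2; rewrite d1 h1 d2 h2 ltnn => /(_ erefl hlt).
Qed.

(** The number of entries smaller than [v] in row [i] and in the first
    [j] columns. *)
Definition lowcount T j i v : nat := \sum_(c < j) (entry T i c < v).

Lemma lowcountP T j i v c : semistandard T -> c < j ->
  (entry T i c < v) = (c < lowcount T j i v).
Proof.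
move=> ss h; apply: (count_initial (p := fun c => entry T i c < v)) => // x y xy.
by apply: leq_ltn_trans; exact: entry_row.
Qed.

Lemma lowcount_le T j i v : lowcount T j i v <= j.
Proof.
rewrite -[X in _ <= X]card_ord -sum1_card leq_sum // => d _.
by case: ltnP.
Qed.

Lemma lowcount_mono T j i u v : u <= v -> lowcount T j i u <= lowcount T j i v.
Proof.
move=> uv; apply: leq_sum => c _; case: ltnP => // h.
by rewrite (leq_trans h).
Qed.

(** Columns increase strictly: below an entry at most [v] the entry above is
    smaller than [v]. *)
Lemma lowcount_next T j i v : semistandard T -> v < n ->
  lowcount T j i.+1 v.+1 <= lowcount T j i v.
Proof.
move=> ss vn; apply: leq_sum => c _; case: ltnP => // h.
have := entry_col (i := i) (i' := i.+1) (c := c) ss (ltnSn _) (leq_trans h vn).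
by move=> h'; rewrite (leq_trans h').
Qed.

Lemma lowcount_default T j i v : size la <= i -> v <= n -> lowcount T j i v = 0.
Proof.
move=> h vn; apply: big1 => c _.
by rewrite entry_out ?rowlen_default // ltnNge vn.
Qed.

Lemma sum_eq_lowcount T j i v :
  (\sum_(c < j) (entry T i c == v)) + lowcount T j i v = lowcount T j i v.+1.
Proof.
by rewrite -big_split; apply: eq_bigr => c _ /=; lia.
Qed.

(** Since the right of column [j] cancels, this counts the entries [v] of the
    first [j] columns row by row. *)
Lemma content_lowcount T j v : v < n ->
  content T 0 v + \sum_(i < size la) lowcount T j i v =
  content T j v + \sum_(i < size la) lowcount T j i v.+1.
Proof.
move=> vn; have hM : rowlen la 0 <= rowlen la 0 + j by rewrite leq_addr.
have hj : j <= rowlen la 0 + j by rewrite leq_addl.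
rewrite !(contentE _ _ hM) // -!big_split; apply: eq_bigr => i _ /=.
rewrite -[lowcount T j i v.+1]sum_eq_lowcount addnA; congr addn.
rewrite (big_ord_widen _ (fun c => nat_of_bool (entry T i c == v)) hj).
rewrite [X in _ = _ + X]big_mkcond -big_split; apply: eq_bigr => c _ /=.
by case: ltnP => h; lia.
Qed.

End Tableaux.

(** * The Bender-Knuth involution on the first columns of a tableau *)

Section BenderKnuth.

Variables (la : intpart) (n : nat) (j : nat) (k k' : 'I_n).
Hypothesis hk : k' = k.+1 :> nat.
Implicit Types (T : {ffun box la -> 'I_n}) (b : box la).

(** In row [i], restricted to the first [j] columns, the entries [k] and
    [k + 1] occupy an interval.  The part of it whose entries are not forced by
    the neighbouring rows runs from [bk_lo T i] to [bk_hi T i]. *)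
Definition bk_lo T i := maxn (lowcount T j i k) (lowcount T j i.+1 k.+2).

Definition bk_hi T i :=
  minn (lowcount T j i k.+2) (if i is i'.+1 then lowcount T j i' k else j).

(** The column where row [i] passes from [k] to [k + 1] after the involution:
    the free interval is reflected. *)
Definition bk_bound T i := bk_lo T i + bk_hi T i - lowcount T j i k.+1.

(** The Bender-Knuth involution exchanging the numbers of entries [k] and
    [k + 1] in the columns smaller than [j]. *)
Definition bk T : {ffun box la -> 'I_n} :=
  [ffun b => if (box_col b < j) && (k <= T b < k.+2)
             then if box_col b < bk_bound T (box_row b) then k else k'
             else T b].

Lemma bkE T b : bk T b =
  (if (box_col b < j) && (k <= T b < k.+2)
   then if box_col b < bk_bound T (box_row b) then k : nat else k.+1
   else T b) :> nat.
Proof. by rewrite ffunE; case: ifP => // _; case: ifP. Qed.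

Let hk2 : k.+2 <= n. Proof. by rewrite -hk. Qed.
Let k_n : k <= n. Proof. exact: ltnW. Qed.
Let k_k1 : k != k.+1 :> nat. Proof. by rewrite neq_ltn ltnSn. Qed.
Let k2_k1 : k.+2 != k.+1. Proof. by rewrite neq_ltn ltnSn orbT. Qed.

Lemma bk_bounds T i : semistandard T ->
  bk_lo T i <= lowcount T j i k.+1 <= bk_hi T i.
Proof.
move=> ss; rewrite /bk_lo /bk_hi geq_max leq_min.
rewrite !lowcount_mono //= (lowcount_next _ _ ss hk2) /=.
by case: i => [|i]; rewrite ?lowcount_le // lowcount_next // ltnW.
Qed.

Lemma bk_bound_bounds T i : semistandard T ->
  bk_lo T i <= bk_bound T i <= bk_hi T i.
Proof. by move=> ss; have := bk_bounds i ss; rewrite /bk_bound; lia. Qed.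

Lemma low_box T b v : semistandard T -> box_col b < j ->
  (T b < v) = (box_col b < lowcount T j (box_row b) v).
Proof. by move=> ss h; rewrite -lowcountP // entry_box. Qed.

(** Rows stay weakly increasing across column [j] because it has no entry [k]:
    an entry [k] further left may become [k + 1]. *)
Lemma bk_semistandard T : semistandard T ->
  (forall b, box_col b = j -> T b != k :> nat) -> semistandard (bk T).
Proof.
move=> ss hj; have /semistandardP st := ss; apply/semistandardP => b b'; split.
- move=> er ec; rewrite !bkE er.
  have st1 := (st b b').1 er ec.
  case: (ltnP (box_col b) j) => cj; last first.
    suff -> : (box_col b' < j) = false by [].
    by apply/negbTE; rewrite -leqNgt (leq_trans cj (ltnW ec)).
  case: (ltnP (box_col b') j) => cj'; rewrite !(andTb, andFb).
    by repeat case: ifP => ?; lia.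
  case: (boolP (k <= T b < k.+2)) => // hb.
  suff : T b' != k :> nat by move/eqP => ne; case: ifP => _; lia.
  apply/eqP => e'.
  have [d [d1 d2]] : exists d : box la, box_row d = box_row b /\ box_col d = j.
    by apply: box_ex; rewrite er; apply: leq_ltn_trans (box_colP b').
  have /eqP[] : T d != k :> nat by apply: hj.
  apply/eqP; rewrite eqn_leq.
  have h1 := (st b d).1; rewrite d1 d2 in h1.
  have h2 : T d <= T b'.
    move: cj'; rewrite leq_eqVlt => /orP[/eqP cj'|cj'].
      by rewrite (box_inj (b := d) (b' := b')) // ?d1 ?d2.
    by apply: (st d b').1; rewrite ?d1 ?d2.
  by rewrite -{1}e' h2; apply: leq_trans (h1 erefl cj); case/andP: hb.
- move=> ec er; rewrite !bkE -ec.
  have st2 := (st b b').2 ec er.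
  case: (ltnP (box_col b) j) => cj; rewrite !(andTb, andFb) //.
  case: (boolP (k <= T b < k.+2)) => hb;
    case: (boolP (k <= T b' < k.+2)) => hb'; try by repeat case: ifP => _; lia.
  have er1 : box_row b' = (box_row b).+1.
    apply/eqP; rewrite eqn_leq er andbT leqNgt; apply/negP => h.
    have l1 := entry_col (c := box_col b) ss (ltnSn (box_row b)).
    have l2 := entry_col (c := box_col b) ss h.
    rewrite entry_box in l1.
    have eb' : entry T (box_row b') (box_col b) = T b' by rewrite ec entry_box.
    rewrite eb' in l2.
    have l3 := l2 (ltn_ord _).
    have l4 := l1 (ltn_trans l3 (ltn_ord _)).
    by lia.
  have b1 := bk_bound_bounds (box_row b) ss.
  have b2 := bk_bound_bounds (box_row b') ss.
  rewrite er1 in b2 *.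
  have cj' : box_col b' < j by rewrite -ec.
  have f1 := low_box k.+2 ss cj'; rewrite er1 -ec in f1.
  have f2 := low_box k ss cj.
  move: b1 b2; rewrite /bk_lo /bk_hi !geq_max !leq_min.
  move=> /andP[/andP[_ b1] _] /andP[_ /andP[_ b2]].
  have {}f1 : box_col b < lowcount T j (box_row b).+1 k.+2.
    by rewrite -f1; case/andP: hb'.
  have {}f2 : lowcount T j (box_row b) k <= box_col b.
    by rewrite leqNgt -f2 -leqNgt; case/andP: hb.
  have -> : box_col b < bk_bound T (box_row b) by exact: leq_trans f1 b1.
  suff -> : (box_col b < bk_bound T (box_row b).+1) = false by [].
  by apply/negbTE; rewrite -leqNgt (leq_trans b2 f2).
Qed.

Lemma bk_low T b v : v != k.+1 -> (bk T b < v) = (T b < v).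
Proof. by rewrite bkE; case: ifP => // /andP[_ h]; case: ifP => _; lia. Qed.

Lemma bk_entry_low T i c v : v <= n -> v != k.+1 ->
  (entry (bk T) i c < v) = (entry T i c < v).
Proof.
move=> vn hv; case: (ltnP c (rowlen la i)) => h; last by rewrite !entry_out.
by have [b [<- <-]] := box_ex h; rewrite !entry_box bk_low.
Qed.

Lemma bk_lowcount T i v : v <= n -> v != k.+1 ->
  lowcount (bk T) j i v = lowcount T j i v.
Proof. by move=> vn hv; apply: eq_bigr => c _; rewrite bk_entry_low. Qed.

Lemma bk_lowcount_mid T i : semistandard T ->
  lowcount (bk T) j i k.+1 = bk_bound T i.
Proof.
move=> ss; have bb := bk_bound_bounds i ss.
have hj : bk_bound T i <= j.
  by have := lowcount_le T j i k.+2; move: bb; rewrite /bk_hi; lia.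
transitivity (\sum_(c < j) (c < bk_bound T i)); last first.
  transitivity (\sum_(c < bk_bound T i) 1); last by rewrite sum1_card card_ord.
  rewrite (big_ord_widen j (fun _ => 1) hj) [RHS]big_mkcond.
  by apply: eq_bigr => c _; case: (c < _).
apply: eq_bigr => c _; congr nat_of_bool.
have r1 : bk_bound T i <= rowlen la i.
  have : bk_bound T i <= lowcount T j i k.+2 by move: bb; rewrite /bk_hi; lia.
  case: (ltnP (rowlen la i) j) => hr.
    move=> h; apply: leq_trans h _; rewrite leqNgt -lowcountP //.
    by rewrite entry_out // -leqNgt.
  by move=> _; exact: leq_trans hr.
case: (ltnP c (rowlen la i)) => h; last first.
  rewrite entry_out // [RHS]ltnNge (leq_trans r1 h) /=; apply/negbTE.
  by rewrite -leqNgt ltnW.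
have [b [eb eb']] := box_ex h; rewrite -eb -eb' entry_box bkE eb eb' ltn_ord andTb.
have cj : box_col b < j by rewrite eb' ltn_ord.
have f1 := low_box k ss cj; have f2 := low_box k.+2 ss cj.
rewrite eb eb' in f1 f2; move: bb; rewrite /bk_lo /bk_hi.
by repeat case: ifP => ?; lia.
Qed.

Lemma bk_involutive T : semistandard T -> bk (bk T) = T.
Proof.
move=> ss; apply/ffunP => b; apply: val_inj; rewrite [LHS]bkE -[RHS]/(nat_of_ord (T b)).
have eb : bk_bound (bk T) (box_row b) = lowcount T j (box_row b) k.+1.
  have -> : bk_bound (bk T) (box_row b) =
            bk_lo T (box_row b) + bk_hi T (box_row b) - bk_bound T (box_row b).
    rewrite {1}/bk_bound /bk_lo /bk_hi bk_lowcount_mid // !bk_lowcount //.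
    by case: (box_row b) => // i; rewrite bk_lowcount.
  have := bk_bounds (box_row b) ss; have := bk_bound_bounds (box_row b) ss.
  by rewrite /bk_bound; lia.
rewrite eb bkE; case: (ltnP (box_col b) j) => cj; rewrite !(andTb, andFb) //.
have f := low_box k.+1 ss cj.
case: (boolP (k <= T b < k.+2)) => h; last by rewrite (negbTE h).
have -> : k <= (if box_col b < bk_bound T (box_row b) then k : nat else k.+1) < k.+2.
  by case: ifP => _; rewrite ?leqnn ?ltnSn ?leqnSn //= ltnW.
by rewrite -f; case: ltnP; lia.
Qed.

Lemma bk_content_right T j' v : j <= j' -> content (bk T) j' v = content T j' v.
Proof.
move=> h; apply: eq_bigr => b _; case: leqP => //= h'.
by rewrite bkE ltnNge (leq_trans h h').
Qed.

Lemma bk_content_other T j' v : v != k :> nat -> v != k.+1 ->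
  content (bk T) j' v = content T j' v.
Proof.
move=> h1 h2; apply: eq_bigr => b _; congr (nat_of_bool (_ && _)).
rewrite bkE; case: ifP => // /andP[_ h].
by case: ifP => _; apply/eqP/eqP; move: h h1 h2; lia.
Qed.

(** Summed over the rows, the lower and upper ends of the free intervals
    telescope. *)
Lemma sum_bk_bound T : semistandard T ->
  \sum_(i < size la) bk_bound T i + \sum_(i < size la) lowcount T j i k.+1 =
  \sum_(i < size la) lowcount T j i k + \sum_(i < size la) lowcount T j i k.+2.
Proof.
move=> ss; transitivity (\sum_(i < size la) (bk_lo T i + bk_hi T i)).
  rewrite -big_split; apply: eq_bigr => i _ /=.
  by have := bk_bounds i ss; rewrite /bk_bound; lia.
have tele L : \sum_(i < L) (bk_lo T i + bk_hi T i) + bk_hi T L =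
    lowcount T j 0 k.+2 +
      \sum_(i < L) (lowcount T j i k + lowcount T j i.+1 k.+2).
  elim: L => [|L IH].
    by rewrite !big_ord0 /bk_hi addn0; have := lowcount_le T j 0 k.+2; lia.
  have : bk_lo T L + bk_hi T L.+1 = lowcount T j L k + lowcount T j L.+1 k.+2.
    by rewrite /bk_lo /bk_hi; lia.
  move=> e.
  have -> : \sum_(i < L.+1) (bk_lo T i + bk_hi T i) =
      \sum_(i < L) (bk_lo T i + bk_hi T i) + (bk_lo T L + bk_hi T L).
    by rewrite big_ord_recr.
  have -> : \sum_(i < L.+1) (lowcount T j i k + lowcount T j i.+1 k.+2) =
      \sum_(i < L) (lowcount T j i k + lowcount T j i.+1 k.+2) +
      (lowcount T j L k + lowcount T j L.+1 k.+2).
    by rewrite big_ord_recr.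
  by lia.
have := tele (size la).
have -> : bk_hi T (size la) = 0 by rewrite /bk_hi lowcount_default // min0n.
rewrite addn0 => ->; rewrite big_split /= addnCA; congr addn.
transitivity (\sum_(i < (size la).+1) lowcount T j i k.+2).
  by rewrite big_ord_recl.
by rewrite big_ord_recr /= [lowcount T j (size la) _]lowcount_default // addn0.
Qed.

(** On the first [j] columns the numbers of entries [k] and [k + 1] are
    exchanged. *)
Lemma bk_content_k T : semistandard T ->
  content (bk T) 0 k + content T j k.+1 = content T 0 k.+1 + content T j k.
Proof.
move=> ss; have kn : k < n by [].
have e1 := content_lowcount (bk T) j kn.
have e2 := content_lowcount T j hk2.
have e3 := sum_bk_bound ss.
rewrite (bk_content_right _ _ (leqnn j)) in e1.
have e4 : \sum_(i < size la) lowcount (bk T) j i k =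
          \sum_(i < size la) lowcount T j i k.
  by apply: eq_bigr => i _; exact: bk_lowcount.
have e5 : \sum_(i < size la) lowcount (bk T) j i k.+1 =
          \sum_(i < size la) bk_bound T i.
  by apply: eq_bigr => i _; apply: bk_lowcount_mid.
rewrite e4 e5 in e1.
lia.
Qed.

Lemma bk_content_k1 T : semistandard T ->
  content (bk T) 0 k.+1 + content T j k = content T 0 k + content T j k.+1.
Proof.
move=> ss; have kn : k < n by [].
have e1 := content_lowcount (bk T) j hk2.
have e2 := content_lowcount T j kn.
have e3 := sum_bk_bound ss.
rewrite (bk_content_right _ _ (leqnn j)) in e1.
have e4 : \sum_(i < size la) lowcount (bk T) j i k.+2 =
          \sum_(i < size la) lowcount T j i k.+2.
  by apply: eq_bigr => i _; exact: bk_lowcount.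
have e5 : \sum_(i < size la) lowcount (bk T) j i k.+1 =
          \sum_(i < size la) bk_bound T i.
  by apply: eq_bigr => i _; apply: bk_lowcount_mid.
rewrite e4 e5 in e1.
lia.
Qed.

End BenderKnuth.

(** * Littlewood-Richardson tableaux and the sign-reversing involution *)

Section Violations.

Variables (la mu : intpart) (n : nat).
Implicit Types (T : {ffun box mu -> 'I_n}).

(** The columns [j], [j + 1], ... of [T], added to [la], do not give a
    partition at the rows [v] and [v + 1]. *)
Definition violation T j v : bool :=
  rowlen la v + content T j v < rowlen la v.+1 + content T j v.+1.

(** [T] is a Littlewood-Richardson tableau over [la]: adding to [la] the
    contents of the columns of [T], from right to left, one gets partitions. *)
Definition LRtab T : bool :=
  [forall j : 'I_(rowlen mu 0), forall v : 'I_n, ~~ violation T j v].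

Lemma violation_range T j v : violation T j v -> j < rowlen mu 0 /\ v.+1 < n.
Proof.
rewrite /violation => h; have := rowlen_anti la (leqnSn v).
split; rewrite ltnNge; apply/negP => g.
  by rewrite !content_right in h; lia.
by rewrite [content _ _ v.+1]content_out in h; lia.
Qed.

Lemma LRtabP T : reflect (forall j v,
    rowlen la v.+1 + content T j v.+1 <= rowlen la v + content T j v) (LRtab T).
Proof.
apply: (iffP forallP) => [h j v|h j].
  rewrite leqNgt; apply/negP => vio.
  have [jm vn] := violation_range vio.
  by have /forallP/(_ (Ordinal (ltnW vn)))/negP := h (Ordinal jm).
by apply/forallP => v; rewrite /violation -leqNgt.
Qed.

(** The violation in the last possible column and, there, in the first
    possible row. *)
Definition first_violation T (p : 'I_(rowlen mu 0) * 'I_n) : bool :=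
  [&& violation T p.1 p.2,
   [forall j : 'I_(rowlen mu 0), (p.1 < j) ==> [forall v : 'I_n, ~~ violation T j v]]
   & [forall v : 'I_n, (v < p.2) ==> ~~ violation T p.1 v]].

Lemma first_violation_uniq T p q :
  first_violation T p -> first_violation T q -> p = q.
Proof.
case: p q => [j v] [j' v'] /and3P[/= h1 /forallP h2 /forallP h3].
case/and3P=> /= g1 /forallP g2 /forallP g3.
have ej : j = j'.
  apply/val_inj; case: (ltngtP j j') => // lt.
    by have /implyP/(_ lt)/forallP/(_ v')/negP := h2 j'.
  by have /implyP/(_ lt)/forallP/(_ v)/negP := g2 j.
rewrite -ej in g1 g3 *; congr pair.
apply/val_inj; case: (ltngtP v v') => // lt.
  by have /implyP/(_ lt)/negP := g3 v.
by have /implyP/(_ lt)/negP := h3 v'.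
Qed.

Lemma first_violation_ex T : ~~ LRtab T -> exists p, first_violation T p.
Proof.
move=> bad; pose P (j : 'I_(rowlen mu 0)) := [exists v : 'I_n, violation T j v].
have [j0 Pj0] : exists j, P j.
  by move: bad; rewrite negb_forall => /existsP[j]; rewrite negb_forall =>
    /existsP[v]; rewrite negbK => h; exists j; apply/existsP; exists v.
case: (@arg_maxnP _ j0 P (fun j => j : nat) Pj0) => j /existsP[v0 v0P] jmax.
case: (@arg_minnP _ v0 (fun v => violation T j v) (fun v => v : nat) v0P) => v vP vmin.
exists (j, v); apply/and3P; split=> //=; apply/forallP.
- move=> j'; apply/implyP => lt; apply/forallP => w; apply/negP => vio.
  have /= : j' <= j by apply: jmax; apply/existsP; exists w.
  by rewrite leqNgt lt.
- by move=> w; apply/implyP => lt; apply/negP => /vmin /=; rewrite leqNgt lt.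
Qed.

(** At the first violation the defect is exactly one, because column [j]
    contains [k + 1] but not [k]. *)
Lemma first_violation_defect T p : semistandard T -> first_violation T p ->
  (rowlen la p.2 + content T p.1 p.2).+1 =
     rowlen la p.2.+1 + content T p.1 p.2.+1 /\
  forall b : box mu, box_col b = p.1 -> T b != p.2 :> nat.
Proof.
move=> ss /and3P[h1 /forallP h2 _]; case: p h1 h2 => [j v] /= h1 h2.
have h3 : ~~ violation T j.+1 v.
  apply/negP => vio; have [jm _] := violation_range vio.
  by have /implyP/(_ (ltnSn _))/forallP/(_ v)/negP := h2 (Ordinal jm).
move: h1 h3; rewrite /violation -leqNgt (content_step j v ss) (content_step j v.+1 ss).
case: existsP => [_|nex]; first by case: existsP => _; lia.
move=> h1 h3; split; first by move: h1 h3; case: existsP => _; lia.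
by move=> b eb; apply/eqP => e; apply: nex; exists b; rewrite eb e !eqxx.
Qed.

Lemma first_violation_right T T' (p : 'I_(rowlen mu 0) * 'I_n) :
  (forall j v, p.1 <= j -> content T j v = content T' j v) ->
  first_violation T p = first_violation T' p.
Proof.
case: p => [j v] /= h.
have e j' v' : j <= j' -> violation T j' v' = violation T' j' v'.
  by move=> hj; rewrite /violation !h.
rewrite /first_violation /= e //; congr [&& _, _ & _].
  apply: eq_forallb => j'; case: ltnP => //= lt.
  by apply: eq_forallb => v'; rewrite e // ltnW.
by apply: eq_forallb => v'; rewrite e.
Qed.

End Violations.

(** * Alternants *)

Local Open Scope ring_scope.

(** A sum is unchanged by an involution of its range. *)
Lemma big_involution (R : nmodType) (I : finType) (P : pred I) (phi : I -> I)
    (F : I -> R) :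
  (forall x, P x -> P (phi x)) -> (forall x, P x -> phi (phi x) = x) ->
  \sum_(x | P x) F (phi x) = \sum_(x | P x) F x.
Proof.
move=> h1 h2; rewrite [RHS](reindex_onto phi phi) //.
apply: eq_bigl => x; apply/idP/andP => [h|[h /eqP <-]]; last exact: h1.
by rewrite h1 // h2.
Qed.

(** A symmetric polynomial is one that is fixed by the adjacent
    transpositions. *)
Lemma msym_adjacent (n : nat) (p : {mpoly int[n]}) :
  (forall k k' : 'I_n, k' = k.+1 :> nat -> msym (tperm k k') p = p) ->
  p \is symmetric.
Proof.
move=> h; have step d (i j : 'I_n) : j = (i + d.+1)%N :> nat -> msym (tperm i j) p = p.
  elim: d i j => [|d IH] i j e; first by apply: h; rewrite e addn1.
  have ln : (i + d.+1 < n)%N.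
    by apply: leq_ltn_trans (ltn_ord j); rewrite e leq_add2l.
  pose l := Ordinal ln.
  have lj : tperm l j = tperm j l by rewrite tpermC.
  have -> : tperm i j = (tperm i l ^ tperm l j)%g.
    rewrite tpermJ tpermL tpermD //.
    - by apply/eqP => /(congr1 val) /= /eqP; rewrite -[X in _ == X]addn0 eqn_add2l.
    - by apply/eqP => /(congr1 val) /= /eqP; rewrite e -[X in _ == X]addn0 eqn_add2l.
  have s1 : msym (tperm l j) p = p by apply: h; rewrite e /= addnS.
  by rewrite /conjg tpermV !msymMm s1 IH.
have tp (i j : 'I_n) : msym (tperm i j) p = p.
  case: (ltngtP i j) => c.
  - by apply: (step (j - i).-1); lia.
  - by rewrite tpermC; apply: (step (i - j).-1); lia.
  - by rewrite (val_inj c) tperm1 msym1m.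
apply/issymP => s; have [ts -> _] := prod_tpermP s.
elim: ts => [|t ts IH]; first by rewrite big_nil msym1m.
by rewrite big_cons msymMm tp.
Qed.

Section Alternants.

Variable n : nat.

(** The monomial with exponents [f 0, ..., f (n - 1)]. *)
Definition mon (f : nat -> nat) : 'X_{1..n} := [multinom f i | i < n].

Lemma monD f g : (mon f + mon g)%MM = mon (fun i => f i + g i)%N.
Proof. by apply/mnmP => i; rewrite mnmDE !mnmE. Qed.

Lemma eq_mon f g : (forall i, (i < n)%N -> f i = g i) -> mon f = mon g.
Proof. by move=> h; apply/mnmP => i; rewrite !mnmE h. Qed.

(** The alternant: the antisymmetrization of a monomial. *)
Definition alt (m : 'X_{1..n}) : {mpoly int[n]} :=
  \sum_(s : 'S_n) (-1) ^+ s *: msym s 'X_[m].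

Lemma alt_tperm (m m' : 'X_{1..n}) (i j : 'I_n) : i != j ->
  'X_[m'] = msym (tperm i j) 'X_[m] :> {mpoly int[n]} -> alt m' = - alt m.
Proof.
move=> ij e; rewrite /alt e -sumrN.
rewrite [RHS](reindex_inj (mulgI (tperm i j))); apply: eq_bigr => s _ /=.
by rewrite msymMm odd_permM odd_tperm ij signr_addb expr1 mulN1r scaleNr opprK.
Qed.

Lemma alt_mul_sym m (p : {mpoly int[n]}) : p \is symmetric ->
  alt m * p = \sum_(s : 'S_n) (-1) ^+ s *: msym s ('X_[m] * p).
Proof.
move=> /issymP h; rewrite /alt mulr_suml; apply: eq_bigr => s _.
by rewrite msymM h scalerAl.
Qed.

Lemma strict_perm_id (f g : nat -> nat) (s : 'S_n) :
  (forall i j, (i < j)%N -> (j < n)%N -> (f j < f i)%N) ->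
  (forall i j, (i < j)%N -> (j < n)%N -> (g j < g i)%N) ->
  (forall i : 'I_n, f (s i) = g i) -> s = 1%g.
Proof.
move=> hf hg e.
have mono (i j : 'I_n) : (i < j)%N -> (s i < s j)%N.
  move=> ij; have := hg i j ij (ltn_ord j); rewrite -!e.
  case: (ltngtP (s i) (s j)) => // [h|h].
    by have := hf _ _ h (ltn_ord _); case: ltngtP.
  by rewrite h ltnn.
have ge (i : 'I_n) : (i <= s i)%N.
  case: i => i; elim: i => // i IH hi.
  have hi' := ltnW hi.
  exact: leq_ltn_trans (IH hi') (mono (Ordinal hi') (Ordinal hi) (ltnSn i)).
have le d (i : 'I_n) : (d + i = n.-1)%N -> (s i <= i)%N.
  elim: d i => [|d IH] i ei.
    by have := ltn_ord (s i); lia.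
  have hi : (i.+1 < n)%N by have := ltn_ord i; lia.
  have e1 : (d + Ordinal hi = n.-1)%N by rewrite /= addnS.
  by have := mono i (Ordinal hi) (ltnSn i); have /= := IH (Ordinal hi) e1; lia.
apply/permP => i; rewrite perm1; apply/val_inj/eqP; rewrite eqn_leq ge andbT.
by apply: (le (n.-1 - i)%N); have := ltn_ord i; lia.
Qed.

Lemma mcoeff_alt f g :
  (forall i j, (i < j)%N -> (j < n)%N -> (f j < f i)%N) ->
  (forall i j, (i < j)%N -> (j < n)%N -> (g j < g i)%N) ->
  (alt (mon f))@_(mon g) = (mon f == mon g)%:R.
Proof.
move=> hf hg; rewrite /alt raddf_sum /= (bigD1 1%g) //=.
rewrite odd_perm1 expr0 scale1r msym1m mcoeffX big1 ?addr0 // => s s1.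
rewrite mcoeffZ msymX mcoeffX; case: eqP => [e|]; last by rewrite mulr0.
case/eqP: s1; apply: invg_inj; rewrite invg1.
apply: (strict_perm_id hf hg) => i.
by have := congr1 (fun m : 'X_{1..n} => m i) e; rewrite mnmE !mnmE.
Qed.

End Alternants.

(** * Products of Schur polynomials *)

Local Open Scope ring_scope.

Lemma schurE n mu : schur n mu =
  \sum_(T : {ffun box mu -> 'I_n} | semistandard T) 'X_[mon n (content T 0)].
Proof.
apply: eq_bigr => T _; rewrite mprodXE; congr mpolyX.
apply/mnmP => i; rewrite mnm_sumE mnmE; apply: eq_bigr => b _.
by rewrite mnm1E.
Qed.

Lemma schur_sym n mu : schur n mu \is symmetric.
Proof.
apply: msym_adjacent => k k' hk; rewrite schurE raddf_sum.
pose M := rowlen mu 0.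
have nM (T : {ffun box mu -> 'I_n}) b : box_col b = M -> T b != k :> nat.
  by move=> e; have := box_colP b; rewrite e ltnNge rowlen_anti.
rewrite -[RHS](big_involution (phi := bk M k k')).
- apply: eq_bigr => T ss; rewrite [LHS]msymX; congr mpolyX.
  apply/mnmP => i; rewrite !mnmE tpermV.
  have r v : content T M v = 0%N by exact: content_right.
  have := bk_content_k M hk ss; have := bk_content_k1 M hk ss.
  rewrite !r !addn0 => e1 e2.
  case: tpermP => [->|->|/eqP h1 /eqP h2]; rewrite ?e2 ?hk ?e1 //.
  by rewrite bk_content_other // -?hk.
- by move=> T ss; apply: bk_semistandard => // b; exact: nM.
- by move=> T ss; exact: bk_involutive.
Qed.

Lemma mpoly_eq_opp0 n (p : {mpoly int[n]}) : p = - p -> p = 0.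
Proof.
move=> e; apply/mpolyP => m; have := congr1 (mcoeff m) e.
by rewrite mcoeffN mcoeff0; lia.
Qed.

(** The exponents [f + rho], where [rho] is [(n - 1, n - 2, ..., 0)]. *)
Definition shifted n (f : nat -> nat) : 'X_{1..n} := mon n (fun v => f v + (n - v.+1))%N.

Section Product.

Variables (n : nat) (la mu : intpart).
Implicit Types T : {ffun box mu -> 'I_n}.

(** The partition [la] plus the content of [T], as a function. *)
Definition sumrow T v := (rowlen la v + content T 0 v)%N.

(** The tableaux whose first violation is at [p] cancel in pairs under the
    Bender-Knuth involution on the columns left of [p.1]. *)
Lemma violation_cancel (p : 'I_(rowlen mu 0) * 'I_n) :
  \sum_(T : {ffun box mu -> 'I_n} | semistandard T && first_violation la T p)
     alt (shifted n (sumrow T)) = 0.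
Proof.
case: (ltnP p.2.+1 n) => hv; last first.
  apply: big1 => T /andP[_ /and3P[/violation_range[_ h] _ _]].
  by move: h; rewrite ltnNge hv.
pose k' := Ordinal hv; pose j := p.1; pose k := p.2.
have hk : k' = k.+1 :> nat by [].
have hkn : (k.+1 < n)%N by [].
clearbody k'.
apply: mpoly_eq_opp0; rewrite -[LHS](big_involution (phi := bk j k k')).
- rewrite -sumrN; apply: eq_bigr => T /andP[ss fv].
  have kk : k != k' by rewrite -val_eqE /= hk neq_ltn ltnSn.
  apply: (alt_tperm kk); rewrite msymX; congr mpolyX.
  have [d _] := first_violation_defect ss fv.
  have e1 := bk_content_k j hk ss; have e2 := bk_content_k1 j hk ss.
  apply/mnmP => i; rewrite !mnmE tpermV /sumrow.
  case: tpermP => [->|->|/eqP h1 /eqP h2].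
  + by move: d e1; rewrite -/j -/k hk; clear - hkn; lia.
  + by move: d e2; rewrite -/j -/k hk; clear - hkn; lia.
  + by rewrite bk_content_other // -?hk.
- move=> T /andP[ss fv]; have [_ hj] := first_violation_defect ss fv.
  rewrite bk_semistandard //=.
  rewrite -(@first_violation_right _ _ _ T) // => j' v h.
  by rewrite bk_content_right.
- by move=> T /andP[ss _]; exact: bk_involutive.
Qed.

(** Only the Littlewood-Richardson tableaux contribute to the product of an
    alternant and a Schur polynomial. *)
Lemma alt_mul_schur : alt (shifted n (rowlen la)) * schur n mu =
  \sum_(T : {ffun box mu -> 'I_n} | semistandard T && LRtab la T)
     alt (shifted n (sumrow T)).
Proof.
rewrite alt_mul_sym ?schur_sym // schurE.
transitivity (\sum_(T : {ffun box mu -> 'I_n} | semistandard T)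
     alt (shifted n (sumrow T))).
  rewrite /alt exchange_big; apply: eq_bigr => s _.
  rewrite mulr_sumr (raddf_sum (msym s)) scaler_sumr; apply: eq_bigr => T _.
  congr (_ *: msym s _); rewrite -mpolyXD monD; congr mpolyX.
  by apply: eq_mon => i _; rewrite /sumrow addnAC.
rewrite (bigID (@LRtab la mu n)) -[RHS]addr0; congr (_ + _).
transitivity (\sum_(p : 'I_(rowlen mu 0) * 'I_n)
  \sum_(T : {ffun box mu -> 'I_n} | semistandard T && first_violation la T p)
     alt (shifted n (sumrow T))); last first.
  by apply: big1 => p _; exact: violation_cancel.
rewrite (exchange_big_dep (fun T => semistandard T && ~~ LRtab la T)) /=.
  apply: eq_bigr => T /andP[ss bad].
  have [p fv] := first_violation_ex bad.
  rewrite (big_pred1 p) // => q; rewrite ss /=.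
  by apply/idP/eqP => [fq|-> //]; exact: first_violation_uniq fq fv.
move=> p T _ /andP[-> /and3P[vio _ _]]; apply/negP => /LRtabP/(_ p.1 p.2).
by rewrite leqNgt; move/negP.
Qed.

End Product.

(** * The bialternant formula *)

Local Open Scope nat_scope.

(** The tableau with entry [f i c] in row [i] and column [c]. *)
Definition funtab (mu : intpart) n (f : nat -> nat -> nat)
    (hf : forall i c, c < rowlen mu i -> f i c < n) : {ffun box mu -> 'I_n} :=
  [ffun b => Ordinal (hf (box_row b) (box_col b) (box_colP b))].

Lemma funtab_content mu n f hf j v : content (@funtab mu n f hf) j v =
  \sum_(i < size mu) \sum_(c < rowlen mu i) ((j <= c) && (f i c == v)).
Proof.
rewrite -(sum_boxE mu (fun i c => (j <= c) && (f i c == v))).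
by apply: eq_bigr => b _; rewrite ffunE.
Qed.

Lemma funtab_semistandard mu n f hf :
  (forall i c c', c < c' -> c' < rowlen mu i -> f i c <= f i c') ->
  (forall i i' c, i < i' -> c < rowlen mu i' -> f i c < f i' c) ->
  semistandard (@funtab mu n f hf).
Proof.
move=> hr hc; apply/semistandardP => b b'; rewrite !ffunE; split => /= e l.
  by rewrite e; apply: hr => //; apply: box_colP.
by rewrite e; apply: hc => //; apply: box_colP.
Qed.

Lemma sum_row_content (mu : intpart) v j :
  \sum_(i < size mu) \sum_(c < rowlen mu i) ((j <= c) && (i == v :> nat)) =
  rowlen mu v - j.
Proof.
case: (ltnP v (size mu)) => hv; last first.
  rewrite rowlen_default // sub0n; apply: big1 => i _; apply: big1 => c _.
  by rewrite andbC; case: eqP => // e; move: hv; rewrite -e leqNgt ltn_ord.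
rewrite (bigD1 (Ordinal hv)) //= [X in _ + X]big1 => [|i ni]; last first.
  apply: big1 => c _; rewrite andbC; case: eqP => // e.
  by case/eqP: ni; apply: val_inj.
rewrite addn0; move: (rowlen mu v) => r; elim: r => [|r IH]; first by rewrite big_ord0.
by rewrite big_ord_recr /= IH eqxx andbT; case: leqP => h; lia.
Qed.

Section Superstandard.

Variables (mu : intpart) (n : nat).
Implicit Types T : {ffun box mu -> 'I_n}.

Hypothesis mu_n : size mu <= n.

Lemma super_bound i c : c < rowlen mu i -> i < n.
Proof.
move=> h; apply: leq_trans mu_n; rewrite -rowlen_gt0.
exact: leq_ltn_trans (leq0n c) h.
Qed.

(** The tableau with entries [i] in row [i]. *)
Definition super : {ffun box mu -> 'I_n} := @funtab mu n (fun i _ => i) super_bound.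

Lemma super_semistandard : semistandard super.
Proof. exact: funtab_semistandard. Qed.

Lemma super_content j v : content super j v = rowlen mu v - j.
Proof. by rewrite funtab_content sum_row_content. Qed.

Lemma super_LRtab : LRtab empty_part super.
Proof.
apply/LRtabP => j v; rewrite !super_content /rowlen !nth_nil !add0n.
by rewrite leq_sub2r // rowlen_anti.
Qed.

End Superstandard.

(** Over the empty partition the only Littlewood-Richardson tableau is the
    superstandard one.  Otherwise take the last column and, there, the first
    row [i] with entry [u + 1 > i].  The lattice condition gives an entry [u]
    in a later column, in row [u] by the choice of the column, and then the
    entry of row [i] in that column is [i], too small. *)
Lemma LRtab_empty mu n (T : {ffun box mu -> 'I_n}) : semistandard T ->
  LRtab empty_part T -> forall b, T b = box_row b :> nat.
Proof.
move=> ss /LRtabP lr.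
suff H d c : rowlen mu 0 <= d + c -> forall i, c < rowlen mu i -> entry T i c = i.
  move=> b; rewrite -entry_box (H (rowlen mu 0)) ?box_colP //.
  by rewrite leq_addr.
elim: d c => [|d IHd] c hc.
  by move=> i; have := rowlen_anti mu (leq0n i); lia.
have later c' i : c < c' -> c' < rowlen mu i -> entry T i c' = i.
  move=> cc' ci; have hc1 : rowlen mu 0 <= d + c' by lia.
  exact: IHd.
elim/ltn_ind => i IHi ci.
have [hi|] := entry_ge_row i c ss; last by rewrite leqNgt ci.
apply/eqP; rewrite eqn_leq hi andbT leqNgt; apply/negP => lt.
case e : (entry T i c) lt => [//|u]; rewrite ltnS => iu.
have := lr c u; rewrite /rowlen !nth_nil !add0n.
rewrite (content_step c u ss) (content_step c u.+1 ss).
have -> : [exists b : box mu, (box_col b == c) && (T b == u.+1 :> nat)].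
  have [b [eb ec]] := box_ex ci.
  by apply/existsP; exists b; rewrite -entry_box eb ec eqxx e eqxx.
have -> : [exists b : box mu, (box_col b == c) && (T b == u :> nat)] = false.
  apply/negbTE/negP => /existsP[b /andP[/eqP ec /eqP eu]].
  have cb := box_colP b; rewrite ec in cb.
  move: eu; rewrite -entry_box ec.
  case: (ltngtP (box_row b) i) => h.
  - by rewrite IHi // => h'; move: h iu; rewrite h'; lia.
  - by have := entry_col ss h (c := c); rewrite entry_lt cb e => /(_ isT); lia.
  - by rewrite h e => /esym /eqP; rewrite ltn_eqF.
rewrite addn0 addn1 => pos.
have : 0 < content T c.+1 u by apply: leq_ltn_trans pos.
rewrite lt0n sum_nat_eq0 => /forallPn[b]; rewrite implyTb eqb0 negbK.
case/andP=> cb /eqP eu.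
have ru : box_row b = u by rewrite -eu -entry_box later // box_colP.
have cbi : box_col b < rowlen mu i.
  by apply: leq_trans (box_colP b) _; rewrite ru rowlen_anti.
have := entry_row i ss (ltnW cb); rewrite e later //; lia.
Qed.

Local Open Scope ring_scope.

(** The Vandermonde alternant, with exponents [rho]. *)
Definition delta n : {mpoly int[n]} := alt (shifted n (fun=> 0%N)).

Lemma shifted_strict n (la : intpart) i j : (i < j)%N -> (j < n)%N ->
  (rowlen la j + (n - j.+1) < rowlen la i + (n - i.+1))%N.
Proof. by move=> ij jn; have := rowlen_anti la (ltnW ij); lia. Qed.

Lemma delta_neq0 n : delta n != 0.
Proof.
have e : delta n = alt (shifted n (rowlen empty_part)).
  by congr alt; apply: eq_mon => i _; rewrite /rowlen nth_nil.
apply/eqP => d0; have := congr1 (mcoeff (shifted n (rowlen empty_part))) d0.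
rewrite e mcoeff0 (mcoeff_alt (@shifted_strict n empty_part)
   (@shifted_strict n empty_part)) eqxx.
by [].
Qed.

(** A Schur polynomial is a quotient of alternants. *)
Lemma schur_bialternant n (mu : intpart) : (size mu <= n)%N ->
  delta n * schur n mu = alt (shifted n (rowlen mu)).
Proof.
move=> h; have := alt_mul_schur n empty_part mu.
have -> : shifted n (rowlen empty_part) = shifted n (fun=> 0%N).
  by apply: eq_mon => i _; rewrite /rowlen nth_nil.
rewrite -/(delta n) => ->; rewrite (big_pred1 (super h)) => [|T].
  by congr alt; apply: eq_mon => i _; rewrite /sumrow super_content subn0 /rowlen nth_nil.
apply/andP/eqP => [[ss lr]|->]; last first.
  by rewrite super_semistandard super_LRtab.
apply/ffunP => b; apply: val_inj; rewrite ffunE.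
exact: LRtab_empty.
Qed.

Lemma schur_eq0 n (mu : intpart) : (n < size mu)%N -> schur n mu = 0.
Proof.
move=> h; apply: big_pred0 => T; apply/negP => ss.
have h0 : (0 < rowlen mu n)%N by rewrite rowlen_gt0.
have [] := entry_ge_row n 0 ss; last by rewrite leqNgt h0.
by rewrite leqNgt entry_lt h0.
Qed.

Section SchurProduct.

Variables (n : nat) (la mu : intpart).

(** The same sum as a partition; this is meaningful when [la] has at most [n]
    rows and [T] is a Littlewood-Richardson tableau over it. *)
Definition sumpart (T : {ffun box mu -> 'I_n}) := of_rows n (sumrow la T).

Hypothesis la_n : (size la <= n)%N.

Lemma rowlen_sumpart T : LRtab la T -> rowlen (sumpart T) =1 sumrow la T.
Proof.
move=> /LRtabP lr i; rewrite /sumpart rowlen_of_rows // => [v|v nv].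
  exact: (lr 0%N v).
by rewrite /sumrow content_out // rowlen_default // (leq_trans la_n).
Qed.

Lemma size_sumpart T : LRtab la T -> (size (sumpart T) <= n)%N.
Proof. by move=> lr; rewrite leqNgt -rowlen_gt0 rowlen_sumpart // /sumrow content_out // rowlen_default. Qed.

(** The Littlewood-Richardson rule for polynomials in [n] variables. *)
Lemma schur_mul : schur n la * schur n mu =
  \sum_(T : {ffun box mu -> 'I_n} | semistandard T && LRtab la T)
     schur n (sumpart T).
Proof.
apply: (mulfI (delta_neq0 n)).
rewrite mulrA schur_bialternant // alt_mul_schur mulr_sumr.
apply: eq_bigr => T /andP[_ lr].
rewrite schur_bialternant ?size_sumpart //; congr alt; apply: eq_mon => i _.
by rewrite rowlen_sumpart.
Qed.

End SchurProduct.

(** * The Littlewood-Richardson rule *)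

Local Open Scope nat_scope.

(** The Littlewood-Richardson tableaux of shape [mu] whose content, added to
    [la], is [nu]; their entries are smaller than [n]. *)
Definition LRset n (la mu nu : intpart) (T : {ffun box mu -> 'I_n}) : bool :=
  [&& semistandard T, LRtab la T & `[< sumrow la T =1 rowlen nu >]].

(** Their number. *)
Definition LRcount n (la mu nu : intpart) : nat := #|@LRset n la mu nu|.

Lemma LRset_sumpart n (la mu nu : intpart) (T : {ffun box mu -> 'I_n}) :
  size la <= n ->
  LRset la nu T = (semistandard T && LRtab la T) && (sumpart la T == nu).
Proof.
move=> hn; rewrite /LRset -andbA; case: (semistandard T) => //=.
case: (boolP (LRtab la T)) => //= lr; apply/asboolP/eqP => [h|<- i].
  by apply: rowlen_inj => i; rewrite rowlen_sumpart.
by rewrite rowlen_sumpart.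
Qed.

Lemma LRset_rowlen n (la mu nu : intpart) (T : {ffun box mu -> 'I_n}) :
  LRset la nu T -> forall v, rowlen nu v = rowlen la v + content T 0 v.
Proof. by move=> /and3P[_ _ /asboolP h] v; rewrite -h. Qed.

(** The number of tableaux does not depend on the bound on the entries, as soon
    as this is at least the number of rows of [nu]. *)
Lemma LRcount_stable n m (la mu nu : intpart) : size nu <= n -> n <= m ->
  LRcount n la mu nu = LRcount m la mu nu.
Proof.
move=> hn hnm.
pose w (T : {ffun box mu -> 'I_n}) : {ffun box mu -> 'I_m} :=
  [ffun b => widen_ord hnm (T b)].
have wE T b : w T b = T b :> nat by rewrite ffunE.
have winj : injective w.
  by move=> T T' e; apply/ffunP => b; apply: val_inj; rewrite /= -!wE e.
have wc T j v : content (w T) j v = content T j v.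
  by apply: eq_bigr => b _; rewrite wE.
have ws T : semistandard (w T) = semistandard T.
  by apply/semistandardP/semistandardP => h b b'; have := h b b'; rewrite !wE.
have wl T : LRset la nu (w T) = LRset la nu T.
  rewrite /LRset ws; congr [&& _, _ & _].
    by apply/LRtabP/LRtabP => h j v; have := h j v; rewrite !wc.
  by apply/asboolP/asboolP => h v; have := h v; rewrite /sumrow wc.
rewrite /LRcount -(fintype.card_image winj); apply: eq_card => T.
apply/fintype.imageP/idP => [[T' hT' ->]|hT].
  by have : LRset la nu (w T') by rewrite wl.
have lt b : T b < n.
  apply: leq_trans hn; rewrite -rowlen_gt0 (LRset_rowlen hT).
  by rewrite /content (bigD1 b) //= eqxx addnCA.
exists [ffun b => Ordinal (lt b)].
  suff : LRset la nu [ffun b => Ordinal (lt b)] by [].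
  rewrite -wl; suff -> : w [ffun b => Ordinal (lt b)] = T by [].
  by apply/ffunP => b; apply: val_inj; rewrite /= wE ffunE.
by apply/ffunP => b; apply: val_inj; rewrite /= wE ffunE.
Qed.

Lemma LRcount_size n (la mu nu : intpart) : size nu <= n ->
  LRcount n la mu nu = LRcount (size nu) la mu nu.
Proof. by move=> h; rewrite -(LRcount_stable _ _ (leqnn _) h). Qed.

Lemma LRcount_sub n (la mu nu : intpart) : 0 < LRcount n la mu nu ->
  forall i, rowlen la i <= rowlen nu i.
Proof. by move=> /card_gt0P[T /LRset_rowlen h] i; rewrite h leq_addr. Qed.

Lemma LRcount_psize n (la mu nu : intpart) : 0 < LRcount n la mu nu ->
  psize nu = psize la + psize mu.
Proof.
move=> /card_gt0P[T /LRset_rowlen h].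
pose N := n + size la + size nu.
rewrite (psizeE (N := N)); last by rewrite leq_addl.
rewrite (psizeE (la := la) (N := N)); last by rewrite /N addnAC leq_addl.
under eq_bigr => i _ do rewrite h.
rewrite big_split /=; congr addn; rewrite exchange_big -card_box -sum1_card.
apply: eq_bigr => b _.
have hb : T b < N by rewrite /N -addnA; apply: leq_trans (leq_addr _ _).
rewrite (bigD1 (Ordinal hb)) //= eqxx big1 // => i ni.
by case: eqP => // e; case/eqP: ni; apply: val_inj; rewrite /= e.
Qed.

Local Open Scope ring_scope.

(** The number of tableaux with the smallest sufficient bound on the entries,
    as an integer. *)
Definition LRcoef (la mu nu : intpart) : int := (LRcount (size nu) la mu nu)%:Z.

Lemma LRcoef_neq0 (la mu nu : intpart) :
  (LRcoef la mu nu != 0) = (0 < LRcount (size nu) la mu nu)%N.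
Proof. by rewrite /LRcoef; case: (LRcount _ _ _ _). Qed.

Lemma fsbig_uniq (R : nmodType) (I : choiceType) (r : seq I) (F : I -> R) :
  uniq r -> (forall i, i \notin r -> F i = 0) ->
  \sum_(i \in [set: I]%classic) F i = \sum_(i <- r) F i.
Proof.
move=> ur h; rewrite (fsbigE r) // => [|i _]; last exact: h.
by apply: eq_bigl => i; rewrite in_setT.
Qed.

Lemma LRcoef_expansion la mu : schur_expansion la mu (LRcoef la mu).
Proof.
split.
  apply: (sub_finite_set _ (finite_psize (psize la + psize mu))) => nu /=.
  by rewrite LRcoef_neq0 => /LRcount_psize ->.
move=> n; case: (leqP (size la) n) => hn; last first.
  rewrite (schur_eq0 hn) mul0r fsbig1 // => nu _.
  case: (eqVneq (LRcoef la mu nu) 0) => [->|]; first by rewrite scale0r.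
  rewrite LRcoef_neq0 => /LRcount_sub h; rewrite schur_eq0 ?scaler0 //.
  apply: leq_trans hn _; rewrite leqNgt -rowlen_gt0 -leqNgt.
  by apply: leq_trans (h _) _; rewrite rowlen_default.
pose G := fun T : {ffun box mu -> 'I_n} => semistandard T && LRtab la T.
pose r := undup [seq sumpart la T | T <- enum G].
have ur : uniq r by exact: undup_uniq.
have coefE nu : LRcoef la mu nu *: schur n nu =
    \sum_(T | G T && (sumpart la T == nu)) schur n (sumpart la T).
  have -> : \sum_(T | G T && (sumpart la T == nu)) schur n (sumpart la T) =
     \sum_(T : {ffun box mu -> 'I_n} | LRset la nu T) schur n nu.
    apply: eq_big => [T|T]; first by rewrite LRset_sumpart.
    by case/andP=> _ /eqP ->.
  rewrite sumr_const -/(LRcount n la mu nu).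
  case: (leqP (size nu) n) => h; last by rewrite schur_eq0 // scaler0 mul0rn.
  by rewrite LRcount_size // /LRcoef -scaler_nat natz.
rewrite (fsbig_uniq ur) => [|nu nr]; last first.
  rewrite coefE big_pred0 // => T; apply/negbTE; apply: contra nr.
  case/andP=> gT /eqP <-; rewrite mem_undup; apply/mapP; exists T => //.
  by rewrite mem_enum.
under eq_bigr => nu _ do rewrite coefE.
rewrite schur_mul // (exchange_big_dep G) /=; last by move=> nu T _ /andP[].
apply: eq_bigr => T gT.
have inr : sumpart la T \in r.
  by rewrite mem_undup; apply/mapP; exists T => //; rewrite mem_enum.
have gT' : G T = true := gT.
rewrite big_mkcond (bigD1_seq _ inr ur) /= gT' eqxx big1 ?addr0 // => nu ne.
by rewrite eq_sym (negbTE ne).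
Qed.

(** The coefficient of an expansion in Schur functions is read off after
    multiplication by [delta]. *)
Lemma expansion_coef (c : intpart -> int) (nu : intpart) :
  finite_set [set mu | c mu != 0]%classic ->
  (delta (size nu) *
     \sum_(mu \in [set: intpart]%classic) c mu *: schur (size nu) mu)
     @_(shifted (size nu) (rowlen nu)) = c nu.
Proof.
move=> fin; pose n := size nu.
have [s es] := (finite_seqP _).1 fin.
pose r := undup (nu :: s).
have ur : uniq r by exact: undup_uniq.
have nr mu : mu \notin r -> c mu = 0.
  rewrite mem_undup inE negb_or => /andP[_].
  apply: contraNeq => h; suff : [set` s]%classic mu by [].
  by rewrite -es.
have inr : nu \in r by rewrite mem_undup inE eqxx.
rewrite (fsbig_uniq ur) => [|mu /nr ->]; last by rewrite scale0r.
rewrite mulr_sumr raddf_sum (bigD1_seq _ inr ur) /= -scalerAr mcoeffZ.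
rewrite schur_bialternant // (mcoeff_alt (@shifted_strict n nu)
  (@shifted_strict n nu)) eqxx mulr1 big1 ?addr0 // => mu ne.
rewrite -scalerAr mcoeffZ; case: (leqP (size mu) n) => h; last first.
  by rewrite schur_eq0 // mulr0 mcoeff0 mulr0.
rewrite schur_bialternant // (mcoeff_alt (@shifted_strict n mu)
  (@shifted_strict n nu)); case: eqP => [e|]; last by rewrite mulr0.
case/eqP: ne; apply: rowlen_inj => i; case: (ltnP i n) => hi; last first.
  by rewrite !rowlen_default // (leq_trans h).
have := congr1 (fun m : 'X_{1..n} => m (Ordinal hi)) e; rewrite !mnmE /=.
by move/addIn.
Qed.

(** Existence is [LRcoef_expansion] and uniqueness is [expansion_coef]. *)
Lemma LR_count (la mu nu : intpart) : LR la mu nu = (LRcount (size nu) la mu nu)%:Z.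
Proof.
rewrite /LR (@xget_unique _ _ _ (LRcoef la mu)) //; first exact: LRcoef_expansion.
move=> c [fin h]; apply/funext => x.
have [fin' h'] := LRcoef_expansion la mu.
by rewrite -[LHS](expansion_coef x fin) -h h' expansion_coef.
Qed.

Lemma LR_sym la mu : LR la mu = LR mu la.
Proof.
rewrite /LR; congr (xget _ _); apply/seteqP.
by split=> c [h1 h2]; split=> // n; rewrite mulrC.
Qed.

Lemma LR_ge0 la mu nu : 0 <= LR la mu nu.
Proof. by rewrite LR_count. Qed.

Lemma LR_neq0 (la mu nu : intpart) :
  (LR la mu nu != 0) = (0 < LRcount (size nu) la mu nu)%N.
Proof. by rewrite LR_count -LRcoef_neq0. Qed.

Lemma LR_psize la mu nu : LR la mu nu != 0 -> psize nu = (psize la + psize mu)%N.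
Proof. by rewrite LR_neq0; exact: LRcount_psize. Qed.

Lemma LR_subl la mu nu i : LR la mu nu != 0 -> (rowlen la i <= rowlen nu i)%N.
Proof. by rewrite LR_neq0 => /LRcount_sub. Qed.

Lemma LR_subr la mu nu i : LR la mu nu != 0 -> (rowlen mu i <= rowlen nu i)%N.
Proof. by rewrite LR_sym; exact: LR_subl. Qed.

(** * Pieri rules and multiplicity-free pairs *)

Local Open Scope nat_scope.

Section ContentDetermines.

Variables (mu : intpart) (n : nat).
Implicit Types T : {ffun box mu -> 'I_n}.

Lemma sum_lowcount_content T v : v <= n ->
  \sum_(i < size mu) lowcount T (rowlen mu 0) i v = \sum_(u < v) content T 0 u.
Proof.
elim: v => [|v IH] vn.
  by rewrite big_ord0; apply: big1 => i _; apply: big1.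
have := content_lowcount T (rowlen mu 0) vn.
by rewrite [content _ (rowlen mu 0) v]content_right // IH ?(ltnW vn) // big_ord_recr /=; lia.
Qed.

(** A tableau with a single row or a single column is determined by its
    content. *)
Lemma thin_entry T b v : semistandard T -> v <= n ->
  size mu <= 1 \/ rowlen mu 0 <= 1 ->
  (T b < v) = (box_row b + box_col b < \sum_(u < v) content T 0 u).
Proof.
move=> ss vn thin; rewrite -sum_lowcount_content //.
have hr := box_rowP b; have hc := box_colP b.
case: thin => h.
  have s1 : size mu = 1 by lia.
  have r0 : box_row b = 0 by lia.
  rewrite s1 big_ord1 r0 add0n; rewrite r0 in hc.
  by have e := entry_box T b; rewrite r0 in e; rewrite -e -lowcountP.
have m1 : rowlen mu 0 = 1 by have := rowlen_anti mu (leq0n (box_row b)); lia.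
have c0 : box_col b = 0 by have := rowlen_anti mu (leq0n (box_row b)); lia.
rewrite c0 addn0 m1.
have -> : \sum_(i < size mu) lowcount T 1 i v = \sum_(i < size mu) (entry T i 0 < v).
  by apply: eq_bigr => i _; rewrite /lowcount big_ord1.
rewrite -(count_initial (p := fun i => entry T i 0 < v)) //.
  by rewrite -{1}c0 entry_box.
move=> a d; rewrite leq_eqVlt => /orP[/eqP -> //|ad] dv.
exact: ltn_trans (entry_col ss ad (leq_trans dv vn)) dv.
Qed.

End ContentDetermines.

(** Partitions with at most one row or at most one column. *)
Definition thin (la : intpart) : Prop := size la <= 1 \/ rowlen la 0 <= 1.

Lemma thin_sub (la mu : intpart) : thin mu ->
  (forall i, rowlen la i <= rowlen mu i) -> thin la.
Proof.
move=> [h|h] sub; [left | right]; last exact: leq_trans (sub 0) h.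
by rewrite leqNgt -rowlen_gt0 -leqNgt; apply: leq_trans (sub 1) _; rewrite rowlen_default.
Qed.

Lemma LRcount_thin n (la mu nu : intpart) : thin mu -> LRcount n la mu nu <= 1.
Proof.
move=> th; apply/fintype.card_le1_eqP => T' T hT' hT.
have e v : content T 0 v = content T' 0 v.
  by have := LRset_rowlen hT v; rewrite (LRset_rowlen hT') => /addnI.
have /and3P[ss _ _] := hT; have /and3P[ss' _ _] := hT'.
have ee b v : v <= n -> (T b < v) = (T' b < v).
  move=> vn; rewrite !thin_entry //; congr (_ < _).
  by apply: eq_bigr => u _.
have l1 b : T b <= T' b by rewrite -ltnS ee.
have l2 b : T' b <= T b by rewrite -ltnS -ee.
by apply/ffunP => b; apply/val_inj/eqP; rewrite eqn_leq l1 l2.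
Qed.

(** The two Pieri conditions: adding a single row adds a horizontal strip, and
    adding a single column adds a vertical strip. *)
Lemma LRset_horizontal n (la mu nu : intpart) (T : {ffun box mu -> 'I_n}) i :
  size mu <= 1 -> LRset la nu T -> rowlen nu i.+1 <= rowlen la i.
Proof.
move=> s1 hT; have /and3P[ss /LRtabP lr _] := hT.
have r0 (b : box mu) : box_row b = 0 by have := box_rowP b; lia.
pose j := lowcount T (rowlen mu 0) 0 i.+1.
have hj b : (T b < i.+1) = (box_col b < j).
  by rewrite -lowcountP -?(r0 b) ?entry_box // box_colP.
(* column [j] is the first one whose entry is larger than [i] *)
have := lr j i; rewrite (LRset_rowlen hT).
have -> : content T j i.+1 = content T 0 i.+1.
  apply: eq_bigr => b _; case: eqP => [e|]; rewrite ?andbF ?andbT //=.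
  by rewrite leqNgt -hj e ltnn.
have -> : content T j i = 0; last by rewrite addn0.
apply: big1 => b _; case: eqP => [e|]; rewrite ?andbF ?andbT //=.
by rewrite leqNgt -hj e ltnSn.
Qed.

Lemma LRset_vertical n (la mu nu : intpart) (T : {ffun box mu -> 'I_n}) i :
  rowlen mu 0 <= 1 -> LRset la nu T -> rowlen nu i <= (rowlen la i).+1.
Proof.
move=> m1 hT; have /and3P[ss _ _] := hT.
rewrite (LRset_rowlen hT) (content_step 0 i ss) content_right //.
by rewrite add0n -addn1 leq_add2l leq_b1.
Qed.

Local Open Scope ring_scope.

Lemma LR_thin (la mu nu : intpart) : thin la -> LR la mu nu = 0 \/ LR la mu nu = 1.
Proof.
move=> th; rewrite LR_sym LR_count.
by case: (LRcount _ _ _ _) (LRcount_thin (size nu) mu nu th) => [|[|]];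
  [left | right | ].
Qed.

Lemma LR_horizontal (la mu nu : intpart) i : (size la <= 1)%N ->
  LR la mu nu != 0 -> (rowlen nu i.+1 <= rowlen mu i)%N.
Proof.
by move=> s1; rewrite LR_sym LR_neq0 => /card_gt0P[T]; exact: LRset_horizontal.
Qed.

Lemma LR_vertical (la mu nu : intpart) i : (rowlen la 0 <= 1)%N ->
  LR la mu nu != 0 -> (rowlen nu i <= (rowlen mu i).+1)%N.
Proof.
by move=> s1; rewrite LR_sym LR_neq0 => /card_gt0P[T]; exact: LRset_vertical.
Qed.

Lemma sub_psize_eq (la mu : intpart) : (forall i, rowlen la i <= rowlen mu i)%N ->
  psize la = psize mu -> la = mu.
Proof.
move=> sub; pose N := (size la + size mu)%N.
rewrite (psizeE (N := N)) ?leq_addr // (psizeE (la := mu) (N := N)) ?leq_addl // => e.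
apply: rowlen_inj => i; apply/eqP; rewrite eqn_leq sub leqNgt; apply/negP => lt.
case: (ltnP i N) => hi; last first.
  by move: lt; rewrite (rowlen_default (la := mu)) // (leq_trans (leq_addl _ _) hi).
move: e; rewrite (bigD1 (Ordinal hi)) // [RHS](bigD1 (Ordinal hi)) //=.
have le : (\sum_(j < N | j != Ordinal hi) rowlen la j <=
   \sum_(j < N | j != Ordinal hi) rowlen mu j)%N by apply: leq_sum => j _.
by move=> e; have := leq_add lt le; rewrite addSn e ltnn.
Qed.

(** Partitions of the same size are equal as soon as one contains the other. *)
Lemma comparable_psize_eq (la mu : intpart) :
  (forall i j, rowlen la i < rowlen mu i -> rowlen mu j < rowlen la j -> False)%N ->
  psize la = psize mu -> la = mu.
Proof.
move=> cmp e; case: (pselect (exists i, rowlen la i < rowlen mu i)%N) => [[i hi]|h].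
  by apply: sub_psize_eq e => j; rewrite leqNgt; apply/negP; exact: cmp hi.
apply/esym/sub_psize_eq => // j; rewrite leqNgt; apply/negP => lt.
by apply: h; exists j.
Qed.

Lemma thin_psize_inj (la mu nu : intpart) : thin nu ->
  (forall i, rowlen la i <= rowlen nu i)%N ->
  (forall i, rowlen mu i <= rowlen nu i)%N ->
  psize la = psize mu -> la = mu.
Proof.
move=> th sl sm; apply: comparable_psize_eq => i j hi hj.
have := sl i; have := sm i; have := sl j; have := sm j.
case: th => h.
  have def k : (0 < k)%N -> rowlen nu k = 0%N.
    by move=> k0; rewrite rowlen_default // (leq_trans h).
  case: (posnP i) => [i0|/def zi]; case: (posnP j) => [j0|/def zj]; try lia.
  by move: hi hj; rewrite i0 j0; lia.
have nu1 k : (rowlen nu k <= 1)%N by apply: leq_trans h; rewrite rowlen_anti.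
have := nu1 i; have := nu1 j.
case: (leqP i j) => ij.
  by have := rowlen_anti la ij; lia.
by have := rowlen_anti mu (ltnW ij); lia.
Qed.

Lemma rowlen_rectangle nu : is_rectangle nu ->
  exists c d, forall i, rowlen nu i = if (i < d)%N then c else 0%N.
Proof. by move=> [c [d e]]; exists c, d => i; rewrite /rowlen e nth_nseq. Qed.

(** Removing a horizontal or a vertical strip of a given size from a rectangle
    is possible in at most one way. *)
Lemma strip_rectangle_uniq (al nu ga ga' : intpart) : thin al -> is_rectangle nu ->
  LR al ga nu != 0 -> LR al ga' nu != 0 -> ga = ga'.
Proof.
move=> th /rowlen_rectangle[c [d e]] h h'.
apply: comparable_psize_eq => [i j hi hj|]; last first.
  by have := LR_psize h; rewrite (LR_psize h') => /addnI.
have si := LR_subr i h'; have sj := LR_subr j h.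
case: th => a1.
  have ui := LR_horizontal i a1 h; have uj := LR_horizontal j a1 h'.
  have ij : i = j.
    by move: si sj ui uj; rewrite !e; repeat case: ifP => ?; lia.
  by move: hi hj; rewrite ij; lia.
have ui := LR_vertical i a1 h; have uj := LR_vertical j a1 h'.
case: (ltngtP i j) => ij.
- have := rowlen_anti ga (ltnW ij); move: si sj ui uj; rewrite !e.
  by repeat case: ifP => ?; lia.
- have := rowlen_anti ga' (ltnW ij); move: si sj ui uj; rewrite !e.
  by repeat case: ifP => ?; lia.
- by move: hi hj; rewrite ij; lia.
Qed.

(** The term of a Newell-Littlewood number at a triple of partitions. *)
Definition NLterm (mu nu la : intpart) (t : intpart * intpart * intpart) : int :=
  let: (al, be, ga) := t in LR al be mu * LR al ga nu * LR be ga la.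

Lemma NLtermE mu nu la :
  NL mu nu la = \sum_(t \in [set: intpart * intpart * intpart]%classic) NLterm mu nu la t.
Proof. by []. Qed.

Lemma NLterm_neq0 mu nu la al be ga : NLterm mu nu la (al, be, ga) != 0 ->
  [/\ LR al be mu != 0, LR al ga nu != 0 & LR be ga la != 0].
Proof. by rewrite /NLterm !mulf_eq0 !negb_or => /andP[/andP[-> ->] ->]. Qed.

Lemma NL_sym mu nu la : NL mu nu la = NL nu mu la.
Proof.
pose h (t : intpart * intpart * intpart) := (t.1.1, t.2, t.1.2).
have hh : involutive h by case=> [[al be] ga].
rewrite !NLtermE (reindex_fsbigT h); last by exists h.
apply: eq_fsbigr => -[[al be] ga] _; rewrite /NLterm /h /=.
by rewrite (LR_sym ga be) (mulrC (LR al ga mu)).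
Qed.

(** The sizes determine [al] and [be] inside a thin [mu]; when they also
    determine [ga], at most one term is nonzero, and it is 1. *)
Lemma NL_le1 (mu nu la : intpart) : thin mu ->
  (forall al be ga ga', NLterm mu nu la (al, be, ga) != 0 ->
     NLterm mu nu la (al, be, ga') != 0 -> ga = ga') ->
  NL mu nu la = 0 \/ NL mu nu la = 1.
Proof.
move=> th uniq_ga; rewrite NLtermE.
have term01 t : NLterm mu nu la t = 0 \/ NLterm mu nu la t = 1.
  case: (eqVneq (NLterm mu nu la t) 0) => [|ne]; [by left | right].
  move: ne; case: t => [[al be] ga] ne; have [h1 h2 h3] := NLterm_neq0 ne.
  have thal : thin al by apply: (thin_sub th) => i; exact: LR_subl h1.
  have thbe : thin be by apply: (thin_sub th) => i; exact: LR_subr h1.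
  move: h1 h2 h3; rewrite /NLterm.
  case: (LR_thin be mu thal) => ->; rewrite ?eqxx // => _.
  case: (LR_thin ga nu thal) => ->; rewrite ?eqxx // => _.
  by case: (LR_thin ga la thbe) => ->; rewrite ?eqxx ?mulr1.
have term_uniq t t' : NLterm mu nu la t != 0 -> NLterm mu nu la t' != 0 -> t = t'.
  case: t t' => [[al be] ga] [[al' be'] ga'] ne ne'.
  have [h1 h2 h3] := NLterm_neq0 ne; have [h1' h2' h3'] := NLterm_neq0 ne'.
  have p1 := LR_psize h1; have p2 := LR_psize h2; have p3 := LR_psize h3.
  have p1' := LR_psize h1'; have p2' := LR_psize h2'; have p3' := LR_psize h3'.
  have ea : al = al'.
    apply: (thin_psize_inj th) => [i|i|]; [exact: LR_subl h1|exact: LR_subl h1'|lia].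
  have eb : be = be'.
    apply: (thin_psize_inj th) => [i|i|]; [exact: LR_subr h1|exact: LR_subr h1'|lia].
  by rewrite -ea -eb in ne' *; rewrite (uniq_ga _ _ _ _ ne ne').
case: (pselect (exists t, NLterm mu nu la t != 0)) => [[t ht]|no]; last first.
  left; apply: fsbig1 => t _; apply/eqP/negPn/negP => h; apply: no.
  by exists t.
rewrite (fsbig_uniq (r := [:: t])) // => [|t']; last first.
  by rewrite inE; apply: contraNeq => h; apply/eqP; exact: term_uniq.
by rewrite big_seq1.
Qed.

Lemma thin_rectangle_free (mu nu : intpart) : thin mu -> is_rectangle nu ->
  NL_multiplicity_free mu nu.
Proof.
move=> th rect la; apply: (NL_le1 th) => al be ga ga' h h'.
have [h1 h2 _] := NLterm_neq0 h; have [_ h2' _] := NLterm_neq0 h'.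
apply: strip_rectangle_uniq rect h2 h2'.
by apply: (thin_sub th) => i; exact: LR_subl h1.
Qed.

Lemma small_free (mu nu : intpart) : (psize mu <= 1)%N -> NL_multiplicity_free mu nu.
Proof.
move=> s1 la; have th : thin mu by left; apply: leq_trans s1; exact: size_leq_psize.
apply: (NL_le1 th) => al be ga ga' h h'.
have [h1 h2 h3] := NLterm_neq0 h; have [_ h2' h3'] := NLterm_neq0 h'.
have p1 := LR_psize h1; have p2 := LR_psize h2; have p3 := LR_psize h3.
have p2' := LR_psize h2'; have p3' := LR_psize h3'.
case: (posnP (psize al)) => a0.
  transitivity nu; last apply/esym; apply: sub_psize_eq; try lia.
    by move=> i; exact: LR_subr h2.
  by move=> i; exact: LR_subr h2'.
transitivity la; last apply/esym; apply: sub_psize_eq; try lia.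
  by move=> i; exact: LR_subr h3.
by move=> i; exact: LR_subr h3'.
Qed.

Lemma NL_multiplicity_free_sym mu nu :
  NL_multiplicity_free mu nu -> NL_multiplicity_free nu mu.
Proof. by move=> h la; rewrite NL_sym. Qed.

(** * Pairs with multiplicity *)

Local Open Scope nat_scope.

Section FunTab.

Variables (mu : intpart) (n : nat) (f : nat -> nat -> nat).
Hypothesis hf : forall i c, c < rowlen mu i -> f i c < n.
Hypothesis ss : semistandard (funtab hf).

(** The contribution of one column. *)
Lemma funtab_content_step j v (p : bool) :
  reflect (exists2 i, j < rowlen mu i & f i j = v) p ->
  content (funtab hf) j v = content (funtab hf) j.+1 v + p.
Proof.
move=> pP; rewrite (content_step j v ss); congr (_ + nat_of_bool _).
apply/existsP/pP => [[b /andP[/eqP hb]]|[i hi e]].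
  rewrite ffunE /= hb => /eqP e; exists (box_row b) => //.
  by rewrite -hb; exact: box_colP.
have [b [eb ec]] := box_ex hi; exists b.
by rewrite ffunE /= eb ec e !eqxx.
Qed.

(** The columns [j, ..., k - 1] contribute as in the superstandard tableau. *)
Lemma funtab_content_super k j v :
  (forall i c, c < k -> f i c = i) -> j <= k ->
  content (funtab hf) j v = content (funtab hf) k v + (minn (rowlen mu v) k - j).
Proof.
move=> hs; elim: {j}(k - j) {-2}j (erefl (k - j)) => [|d IH] j e jk.
  have -> : j = k by lia.
  by rewrite (_ : minn _ _ - k = 0) ?addn0 //; lia.
rewrite (@funtab_content_step j v (j < rowlen mu v)); last first.
  have jk' : j < k by lia.
  by apply: (iffP idP) => [h|[i h]]; [exists v; rewrite ?hs | rewrite hs // => <-].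
by rewrite IH; lia.
Qed.

Lemma funtab_LRset (la nu : intpart) :
  (forall j v, j <= rowlen mu 0 ->
    rowlen la v.+1 + content (funtab hf) j v.+1 <= rowlen la v + content (funtab hf) j v) ->
  (forall v, rowlen la v + content (funtab hf) 0 v = rowlen nu v) ->
  LRset la nu (funtab hf).
Proof.
move=> h1 h2; apply/and3P; split; first exact: ss; last first.
  by apply/asboolP => v; rewrite /sumrow h2.
apply/LRtabP => j v; case: (leqP j (rowlen mu 0)) => hj; first exact: h1.
by rewrite !content_right ?(ltnW hj) // !addn0 rowlen_anti.
Qed.

End FunTab.

Lemma LR_neq0_of n (la mu nu : intpart) (T : {ffun box mu -> 'I_n}) :
  size nu <= n -> LRset la nu T -> (LR la mu nu != 0)%R.
Proof.
move=> hn hT; rewrite LR_neq0 -(LRcount_size _ _ hn).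
by apply/card_gt0P; exists T.
Qed.

Lemma size_leq_rowlen (la : intpart) n : rowlen la n = 0 -> size la <= n.
Proof. by move=> e; rewrite leqNgt -rowlen_gt0 e. Qed.

(** The height of the column [c] of a diagram. *)
Lemma col_height (la : intpart) c : exists h, forall i, (c < rowlen la i) = (i < h).
Proof.
exists (\sum_(i < size la) (c < rowlen la i)) => i.
case: (ltnP i (size la)) => hi.
  apply: (count_initial (p := fun i => c < rowlen la i)) => // a b ab h.
  by apply: leq_trans h _; rewrite rowlen_anti.
rewrite rowlen_default // ltn0; apply/esym/negbTE; rewrite -leqNgt.
apply: leq_trans hi; rewrite -[X in _ <= X]card_ord -sum1_card leq_sum // => d _.
by case: (_ < _).
Qed.

(** Let [be] be [mu] with the box at the end of row [k] removed, and let the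
    last column of [ga] have height [h].  In the product of the Schur functions
    of [be] and [ga] one finds [la], which is [mu] with [h - 1] boxes added
    below its first column and then the other columns of [ga] added row by row;
    [la] does not depend on [k]. *)
Lemma LR_corner (mu be ga la : intpart) k h :
  rowlen mu k.+1 < rowlen mu k ->
  (forall i, rowlen be i = rowlen mu i - (i == k)) ->
  0 < rowlen ga 0 ->
  (forall i, ((rowlen ga 0).-1 < rowlen ga i) = (i < h)) ->
  (forall v, rowlen la v = rowlen mu v + (size mu <= v < size mu + h.-1) +
     minn (rowlen ga v) (rowlen ga 0).-1) ->
  (LR be ga la != 0)%R.
Proof.
set m := rowlen ga 0; set L := size mu => hk ebe m0 hh ela.
have h0 : 0 < h by rewrite -hh -/m prednK.
have kL : k < L by rewrite -rowlen_gt0; lia.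
(* the last column is filled with [k] and the rows below [mu], the other
   columns as in the superstandard tableau *)
pose f i c := if c == m.-1 then if i == 0 then k else L + i.-1 else i.
pose n := L + h + size ga.
have gm i : rowlen ga i <= m by rewrite rowlen_anti.
have ghi i c : c < rowlen ga i -> i < size ga by rewrite -rowlen_gt0; lia.
have hf i c : c < rowlen ga i -> f i c < n.
  by move=> /ghi hi; rewrite /f /n; case: ifP => _; [case: ifP => _|]; lia.
have ss : semistandard (funtab hf).
  apply: funtab_semistandard => [i c c' cc hc'|i i' c ii hc].
    have := gm i; rewrite /f; case: (c =P m.-1) => e1; first lia.
    by case: ifP => _; [case: eqP => ?|]; lia.
  by rewrite /f; case: ifP => _ //; case: eqP => e1; case: eqP => e2; lia.
(* the rows that receive a box from the last column *)
pose S v : bool := (v == k) || (L <= v < L + h.-1).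
have c1 v : content (funtab hf) m.-1 v = S v.
  rewrite (funtab_content_step (p := S v) ss); last first.
    apply: (iffP idP) => [|[i]]; rewrite /S.
      case/orP => [/eqP ->|hv]; first by exists 0; rewrite ?hh // /f eqxx.
      exists (v - L).+1; first by rewrite hh; lia.
      by rewrite /f eqxx /=; lia.
    by rewrite hh /f eqxx; case: eqP => [_ _ <-|i0 ih <-]; rewrite ?eqxx //; lia.
  by rewrite content_right // prednK.
have cS j v : j <= m.-1 ->
    content (funtab hf) j v = S v + (minn (rowlen ga v) m.-1 - j).
  move=> hj; rewrite (@funtab_content_super _ _ _ hf ss m.-1) ?c1 // => i c cm.
  by rewrite /f ltn_eqF.
have mu0 v : L <= v -> rowlen mu v = 0 by exact: rowlen_default.
have mu1 v : v < L -> 0 < rowlen mu v by rewrite rowlen_gt0.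
have eS v : rowlen be v + S v = rowlen mu v + (L <= v < L + h.-1).
  rewrite ebe /S; have := mu1 v; case: (v =P k) => [->|_] /=; last by rewrite subn0.
  by move=> /(_ kL); lia.
apply: (@LR_neq0_of n _ _ _ (funtab hf)).
  apply: size_leq_rowlen; rewrite ela mu0 ?(rowlen_default (la := ga)) ?min0n; rewrite /n; lia.
apply: funtab_LRset => // [j v hj|v]; last first.
  by rewrite cS // addnA eS subn0 ela.
case: (leqP j m.-1) => hj'; last first.
  have -> : j = m by lia.
  by rewrite !content_right // !addn0 rowlen_anti.
rewrite !cS // !addnA !eS.
have hmu := rowlen_anti mu (leqnSn v).
have hga : minn (rowlen ga v.+1) m.-1 <= minn (rowlen ga v) m.-1.
  by have := rowlen_anti ga (leqnSn v); lia.
case: (ltnP v L) => hv.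
  have := mu1 v hv; case: (ltnP v.+1 L) => hv'; last have := mu0 v.+1 hv'; lia.
have := mu0 v hv; have := mu0 v.+1 (leqW hv); lia.
Qed.

(** The partition with the box at the end of row [k] removed. *)
Definition rmbox (mu : intpart) k : intpart :=
  of_rows (size mu) (fun i => rowlen mu i - (i == k)).

Lemma rowlen_rmbox (mu : intpart) k : rowlen mu k.+1 < rowlen mu k ->
  forall i, rowlen (rmbox mu k) i = rowlen mu i - (i == k).
Proof.
move=> hk i; rewrite rowlen_of_rows // => [j|j hj].
  have := rowlen_anti mu (leqnSn j); case: (j =P k) => [->|_]; lia.
by rewrite rowlen_default.
Qed.

Lemma box_is_partition : is_partition [:: 1]. Proof. by []. Qed.

(** The single box. *)
Definition box_part : intpart := IntPart box_is_partition.

(** The case of [LR_corner] where [ga] is a single box. *)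
Lemma LR_box (mu : intpart) k : rowlen mu k.+1 < rowlen mu k ->
  (LR box_part (rmbox mu k) mu != 0)%R.
Proof.
move=> hk; rewrite LR_sym; apply: (@LR_corner mu _ _ _ k 1) => //.
- exact: rowlen_rmbox.
- by move=> [|[|i]].
- by move=> v; rewrite minn0 /=; lia.
Qed.

Lemma last_corner (mu : intpart) : 0 < size mu ->
  rowlen mu (size mu).-1.+1 < rowlen mu (size mu).-1.
Proof. by move=> h; rewrite prednK // rowlen_default // rowlen_gt0 prednK. Qed.

(** A corner other than the last one. *)
Lemma non_rectangle_corner (mu : intpart) : ~ is_rectangle mu ->
  exists2 k, k.+1 < size mu & rowlen mu k.+1 < rowlen mu k.
Proof.
move=> nr; apply: contrapT => h; apply: nr.
exists (rowlen mu 0), (size mu); apply: (@eq_from_nth _ 0); first by rewrite size_nseq.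
move=> i hi; rewrite nth_nseq hi; elim: i hi => [//|i IH] hi.
rewrite -IH ?(ltnW hi) //; apply/eqP; rewrite eqn_leq.
rewrite -!/(rowlen _ _) rowlen_anti //= leqNgt; apply/negP => lt.
by apply: h; exists i.
Qed.

Local Open Scope ring_scope.

Lemma NLterm_ge0 mu nu la t : 0 <= NLterm mu nu la t.
Proof. by case: t => [[al be] ga]; rewrite /NLterm !mulr_ge0 ?LR_ge0. Qed.

(** Terms are nonnegative and finitely many are nonzero. *)
Lemma NL_ge (mu nu la : intpart) (s : seq (intpart * intpart * intpart)) :
  uniq s -> \sum_(t <- s) NLterm mu nu la t <= NL mu nu la.
Proof.
move=> us; pose A : set intpart := [set x | psize x <= psize mu + psize nu]%N%classic.
have finA : finite_set (A `*` A `*` A)%classic.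
  by apply: finite_setX; [apply: finite_setX|]; exact: finite_psize.
have [r er] := (finite_seqP _).1 finA.
pose r' := s ++ [seq t <- undup r | t \notin s].
have ur : uniq r'.
  rewrite cat_uniq us filter_uniq ?undup_uniq // andbT /=.
  by apply/hasPn => t; rewrite mem_filter => /andP[].
rewrite NLtermE (fsbig_uniq ur) => [|[[al be] ga]].
  by rewrite big_cat lerDl; apply: sumr_ge0 => t _; exact: NLterm_ge0.
rewrite mem_cat mem_filter mem_undup negb_or => /andP[ts].
rewrite ts /=; apply: contraNeq => /NLterm_neq0[h1 h2 h3].
have : [set` r]%classic (al, be, ga); last by [].
rewrite -er; have p1 := LR_psize h1; have p2 := LR_psize h2.
by split; [split|]; rewrite /A /=; lia.
Qed.

Lemma NLterm_gt0 mu nu la al be ga :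
  LR al be mu != 0 -> LR al ga nu != 0 -> LR be ga la != 0 ->
  1 <= NLterm mu nu la (al, be, ga).
Proof.
move=> h1 h2 h3; rewrite -gtz0_ge1 lt0r NLterm_ge0 andbT /NLterm.
by rewrite !mulf_neq0.
Qed.

Lemma not_NL_free (mu nu la : intpart) : 2 <= NL mu nu la ->
  ~ NL_multiplicity_free mu nu.
Proof. by move=> h /(_ la)[] e; rewrite e in h. Qed.

Lemma non_rectangle_not_free (mu nu : intpart) : ~ is_rectangle mu ->
  (2 <= psize nu)%N -> ~ NL_multiplicity_free mu nu.
Proof.
move=> nr p2; have [k kL hk] := non_rectangle_corner nr.
have L0 : (0 < size mu)%N by lia.
have hl := last_corner L0; set l := (size mu).-1 in hl.
have nu0 : (0 < size nu)%N.
  rewrite lt0n; apply: contraTneq p2 => /size0nil e.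
  by rewrite /psize e.
have hn := last_corner nu0; set q := (size nu).-1 in hn.
pose ga := rmbox nu q; have ega := rowlen_rmbox hn; rewrite -/ga in ega.
have m0 : (0 < rowlen ga 0)%N.
  rewrite ega /q; have : (0 < rowlen nu 0)%N by rewrite rowlen_gt0.
  case: (0%N =P _) => e; last by rewrite subn0.
  have s1 : (size nu <= 1)%N by lia.
  by move: p2; rewrite (psizeE s1) big_ord1 /=; lia.
have [h hh] := col_height ga (rowlen ga 0).-1.
have h0 : (0 < h)%N by rewrite -hh prednK.
pose F v := (rowlen mu v + (size mu <= v < size mu + h.-1) +
     minn (rowlen ga v) (rowlen ga 0).-1)%N.
pose la := of_rows (size mu + h + size ga) F.
have ela v : rowlen la v = F v.
  apply: rowlen_of_rows => [i|i hi]; rewrite /F.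
    have := rowlen_anti mu (leqnSn i); have := rowlen_anti ga (leqnSn i).
    have := rowlen_default (la := mu) (i := i); have := rowlen_gt0 mu i.
    by case: (ltnP i (size mu)); have := rowlen_default (la := mu) (i := i.+1); lia.
  rewrite (rowlen_default (la := mu)) ?(rowlen_default (la := ga) (i := i)) //; lia.
have t1 : 1 <= NLterm mu nu la (box_part, rmbox mu k, ga).
  apply: NLterm_gt0; [exact: LR_box | exact: LR_box|].
  exact: (LR_corner hk (rowlen_rmbox hk) m0 hh ela).
have t2 : 1 <= NLterm mu nu la (box_part, rmbox mu l, ga).
  apply: NLterm_gt0; [exact: LR_box | exact: LR_box|].
  exact: (LR_corner hl (rowlen_rmbox hl) m0 hh ela).
apply: (@not_NL_free _ _ la).
apply: le_trans (NL_ge _ _ _ (s := [:: (box_part, rmbox mu k, ga); (box_part, rmbox mu l, ga)]) _).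
  by rewrite big_cons big_seq1; apply: (lerD t1 t2).
rewrite /= inE andbT; apply/eqP => -[] e; have := congr1 (fun p => rowlen p k) e.
rewrite (rowlen_rmbox hk) (rowlen_rmbox hl) eqxx.
have -> : (k == l) = false by apply/eqP; rewrite /l; lia.
by rewrite subn0; lia.
Qed.

Local Open Scope nat_scope.

Section TwoColumns.

Variables (ga : intpart) (c d n : nat) (s s' : nat -> nat) (S S' : nat -> bool).
Hypotheses (c2 : 1 < c) (d2 : 1 < d).
Hypothesis ega : forall i, rowlen ga i = if i < d.-1 then c else if i == d.-1 then c.-1 else 0.

(** Filling of a rectangle with [d] rows of length [c], without its last box: as
    in the superstandard tableau except for the entries [s 0, ..., s (d - 2)] of
    the last column and [s' 0, ..., s' (d - 1)] of the column before. *)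
Definition two_columns i j := if j == c.-1 then s i else if j == c.-2 then s' i else i.

Hypotheses (sn : forall i, i < d.-1 -> s i < n) (s'n : forall i, i < d -> s' i < n).
Hypothesis dn : d <= n.
Hypothesis s_incr : forall i i', i < i' -> i' < d.-1 -> s i < s i'.
Hypothesis s'_incr : forall i i', i < i' -> i' < d -> s' i < s' i'.
Hypothesis s's : forall i, i < d.-1 -> s' i <= s i.
Hypothesis s'_ge : forall i, i < d -> i <= s' i.
Hypothesis SP : forall v, reflect (exists2 i, i < d.-1 & s i = v) (S v).
Hypothesis S'P : forall v, reflect (exists2 i, i < d & s' i = v) (S' v).

Lemma two_columns_bound i j : j < rowlen ga i -> two_columns i j < n.
Proof.
rewrite ega /two_columns; case: ifP => [hi|_].
  by move=> _; case: ifP => _; [exact: sn | case: ifP => _; [apply: s'n|]]; lia.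
case: eqP => // -> hj; have -> : (j == c.-1) = false by apply/eqP; lia.
by case: ifP => _; [apply: s'n|]; lia.
Qed.

Definition two_tab := funtab two_columns_bound.

Lemma two_tab_semistandard : semistandard two_tab.
Proof.
apply: funtab_semistandard => [i j j' jj|i i' j ii].
  rewrite ega /two_columns; case: ifP => [hi|_].
    move=> hj'; have -> : (j == c.-1) = false by apply/eqP; lia.
    have h1 := s's hi; have h2 : i <= s' i by apply: s'_ge; lia.
    by repeat case: eqP => ?; lia.
  case: eqP => // hi hj'; have h2 : i <= s' i by apply: s'_ge; lia.
  by repeat case: eqP => ?; lia.
rewrite ega /two_columns; case: ifP => [hi _|_].
  by case: ifP => _; [exact: s_incr | case: ifP => _ //; apply: s'_incr]; lia.
case: eqP => // hi hj; have -> : (j == c.-1) = false by apply/eqP; lia.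
by case: ifP => _ //; apply: s'_incr; lia.
Qed.

(** [S] and [S'] are the sets of entries of the two special columns, whose
    boxes are added to [be] first. *)
Lemma two_tab_LRset (be la : intpart) :
  (forall v, rowlen be v.+1 + S v.+1 <= rowlen be v + S v) ->
  (forall v, rowlen be v.+1 + S v.+1 + S' v.+1 <= rowlen be v + S v + S' v) ->
  (forall v, rowlen la v =
     rowlen be v + S v + S' v + minn (rowlen ga v) c.-2) ->
  LRset be la two_tab.
Proof.
move=> h1 h2 ela; have ss := two_tab_semistandard.
have g0 : rowlen ga 0 = c by rewrite ega; have -> : 0 < d.-1 by lia.
have lt1 i : (c.-1 < rowlen ga i) = (i < d.-1).
  by rewrite ega; case: ifP => _; [|case: ifP => _]; lia.
have lt2 i : (c.-2 < rowlen ga i) = (i < d).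
  by rewrite ega; case: (ltnP i d.-1) => hi; [|case: eqP => e]; lia.
have e2 : c.-2.+1 = c.-1 by lia.
have e1 : c.-1.+1 = c by lia.
have c1 v : content two_tab c.-1 v = S v.
  rewrite /two_tab (funtab_content_step (p := S v) ss); last first.
    apply: (iffP (SP v)) => -[i]; rewrite ?lt1 => hi <-; exists i => //;
      by rewrite ?lt1 // /two_columns eqxx.
  by rewrite content_right // g0 e1.
have c2' v : content two_tab c.-2 v = S v + S' v.
  have ne : (c.-2 == c.-1) = false by apply/eqP; lia.
  rewrite /two_tab (funtab_content_step (p := S' v) ss); last first.
    apply: (iffP (S'P v)) => -[i]; rewrite ?lt2 => hi <-; exists i => //;
      by rewrite ?lt2 // /two_columns ne eqxx.
  by rewrite e2 -[funtab _]/two_tab c1.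
have cj j v : j <= c.-2 ->
    content two_tab j v = S v + S' v + (minn (rowlen ga v) c.-2 - j).
  move=> hj; rewrite /two_tab (@funtab_content_super _ _ _ _ ss c.-2) ?c2' //.
  move=> i k hk; rewrite /two_columns.
  have -> : (k == c.-1) = false by apply/eqP; lia.
  by rewrite ltn_eqF.
apply: funtab_LRset => // [j v|v]; last by rewrite cj // subn0 addnA addnA ela.
rewrite g0 => hj; case: (leqP j c.-2) => hj2.
  rewrite !cj // !addnA; have := h2 v.
  by have := rowlen_anti ga (leqnSn v); lia.
case: (leqP j c.-1) => hj1.
  by have -> : j = c.-1 by [lia]; rewrite !c1.
have -> : j = c by lia.
by rewrite !content_right ?g0 // !addn0 rowlen_anti.
Qed.

End TwoColumns.

(** The product of the Schur functions of two rectangles without their last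
    boxes has a coefficient that is at least two. *)
Lemma LR_rectangles_ge2 (be ga : intpart) a b c d :
  1 < a -> 1 < b -> 1 < c -> 1 < d ->
  (forall i, rowlen be i = if i < b.-1 then a else if i == b.-1 then a.-1 else 0) ->
  (forall i, rowlen ga i = if i < d.-1 then c else if i == d.-1 then c.-1 else 0) ->
  exists la, (2 <= LR be ga la)%R.
Proof.
move=> a2 b2 c2 d2 ebe ega.
(* [S1] and [S2] are the rows filled by the last column in the two tableaux;
   the column before fills row 0 and the rows of the other set, so that the
   total contents agree *)
pose S1 v := b.-1 <= v < b + d.-2.
pose S2 v := b <= v < b + d.-1.
pose s1 i := b.-1 + i.
pose s2 i := b + i.
pose s1' i := if i == 0 then 0 else b + i.-1.
pose s2' i := if i == 0 then 0 else b.-1 + i.-1.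
pose n := b + d.
pose F v := rowlen be v + S1 v + ((v == 0) || S2 v) + minn (rowlen ga v) c.-2.
have gad v : minn (rowlen ga v.+1) c.-2 <= minn (rowlen ga v) c.-2.
  by have := rowlen_anti ga (leqnSn v); lia.
have st1 v : rowlen be v.+1 + S1 v.+1 <= rowlen be v + S1 v.
  by rewrite !ebe /S1; repeat case: ifP => ?; lia.
have st2 v : rowlen be v.+1 + S2 v.+1 <= rowlen be v + S2 v.
  by rewrite !ebe /S2; repeat case: ifP => ?; lia.
have st12 v : rowlen be v.+1 + S1 v.+1 + ((v.+1 == 0) || S2 v.+1) <=
              rowlen be v + S1 v + ((v == 0) || S2 v).
  by rewrite !ebe /S1 /S2; repeat case: ifP => ?; lia.
have sw v : rowlen be v + S2 v + ((v == 0) || S1 v) =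
            rowlen be v + S1 v + ((v == 0) || S2 v).
  by rewrite /S1 /S2; lia.
pose la := of_rows n F.
have ela v : rowlen la v = F v.
  apply: rowlen_of_rows => [i|i hi]; rewrite /F; first by have := st12 i; have := gad i; lia.
  by rewrite ebe ega /S1 /S2 /n in hi *; repeat case: ifP => ?; lia.
have s1n i : i < d.-1 -> s1 i < n by rewrite /s1 /n; lia.
have s2n i : i < d.-1 -> s2 i < n by rewrite /s2 /n; lia.
have s1'n i : i < d -> s1' i < n by rewrite /s1' /n; case: ifP => _; lia.
have s2'n i : i < d -> s2' i < n by rewrite /s2' /n; case: ifP => _; lia.
have dn : d <= n by rewrite /n leq_addl.
have S1P v : reflect (exists2 i, i < d.-1 & s1 i = v) (S1 v).
  apply: (iffP idP) => [h|[i hi <-]]; last by rewrite /S1 /s1; lia.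
  by exists (v - b.-1); move: h; rewrite /S1 /s1; lia.
have S2P v : reflect (exists2 i, i < d.-1 & s2 i = v) (S2 v).
  apply: (iffP idP) => [h|[i hi <-]]; last by rewrite /S2 /s2; lia.
  by exists (v - b); move: h; rewrite /S2 /s2; lia.
have S1'P v : reflect (exists2 i, i < d & s1' i = v) ((v == 0) || S2 v).
  apply: (iffP idP) => [/orP[/eqP ->|h]|[i hi <-]].
  - by exists 0; [lia|].
  - by exists (v - b).+1; move: h; rewrite /S2 /s1' /=; lia.
  - by rewrite /s1' /S2; case: (i =P 0) => ?; lia.
have S2'P v : reflect (exists2 i, i < d & s2' i = v) ((v == 0) || S1 v).
  apply: (iffP idP) => [/orP[/eqP ->|h]|[i hi <-]].
  - by exists 0; [lia|].
  - by exists (v - b.-1).+1; move: h; rewrite /S1 /s2' /=; lia.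
  - by rewrite /s2' /S1; case: (i =P 0) => ?; lia.
pose T1 := two_tab c2 d2 ega s1n s1'n dn.
pose T2 := two_tab c2 d2 ega s2n s2'n dn.
have hT1 : LRset be la T1.
  apply: (@two_tab_LRset ga c d n s1 s1' S1 (fun v => (v == 0) || S2 v)) => //.
  - by move=> i i' ii _; rewrite /s1 ltn_add2l.
  - by move=> i i' ii _; rewrite /s1'; repeat case: eqP => ?; lia.
  - by move=> i _; rewrite /s1 /s1'; case: eqP => ?; lia.
  - by move=> i _; rewrite /s1'; case: eqP => ?; lia.
have hT2 : LRset be la T2.
  apply: (@two_tab_LRset ga c d n s2 s2' S2 (fun v => (v == 0) || S1 v)) => //.
  - by move=> i i' ii _; rewrite /s2 ltn_add2l.
  - by move=> i i' ii _; rewrite /s2'; repeat case: eqP => ?; lia.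
  - by move=> i _; rewrite /s2 /s2'; case: eqP => ?; lia.
  - by move=> i _; rewrite /s2'; case: eqP => ?; lia.
  - by move=> v; rewrite !sw.
  - by move=> v; rewrite sw ela.
have T12 : T1 != T2.
  have h0 : c.-1 < rowlen ga 0 by rewrite ega; have -> : 0 < d.-1 by [lia]; lia.
  have [x [ex ex']] := box_ex h0.
  apply/eqP => /(congr1 (fun T : {ffun box ga -> 'I_n} => T x : nat)).
  by rewrite !ffunE /= ex ex' /two_columns eqxx /s1 /s2; lia.
exists la; rewrite LR_count lez_nat.
rewrite -(@LRcount_size n); last first.
  apply: size_leq_rowlen; rewrite ela /F ebe ega /S1 /S2 /n.
  by repeat case: ifP => ?; lia.
rewrite /LRcount; apply/card_gt1P; exists T1, T2; split=> //.
Qed.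

Local Open Scope ring_scope.

Lemma rowlen_rect_rmbox (mu : intpart) a b : (0 < b)%N -> (0 < a)%N ->
  (forall i, rowlen mu i = if i < b then a else 0)%N ->
  [/\ rowlen mu b.-1.+1 < rowlen mu b.-1 &
   forall i, rowlen (rmbox mu b.-1) i =
     if i < b.-1 then a else if i == b.-1 then a.-1 else 0]%N.
Proof.
move=> b0 a0 e; have hc : (rowlen mu b.-1.+1 < rowlen mu b.-1)%N.
  by rewrite !e prednK // ltnn leqnn.
split=> // i; rewrite (rowlen_rmbox hc) e.
by repeat case: ifP => ?; lia.
Qed.

Lemma rectangles_not_free (mu nu : intpart) a b c d :
  (1 < a)%N -> (1 < b)%N -> (1 < c)%N -> (1 < d)%N ->
  parts mu = nseq b a -> parts nu = nseq d c -> ~ NL_multiplicity_free mu nu.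
Proof.
move=> a2 b2 c2 d2 emu enu.
have rmu i : rowlen mu i = if (i < b)%N then a else 0%N by rewrite /rowlen emu nth_nseq.
have rnu i : rowlen nu i = if (i < d)%N then c else 0%N by rewrite /rowlen enu nth_nseq.
have [hmu ebe] := rowlen_rect_rmbox (ltnW b2) (ltnW a2) rmu.
have [hnu ega] := rowlen_rect_rmbox (ltnW d2) (ltnW c2) rnu.
have [la hla] := LR_rectangles_ge2 a2 b2 c2 d2 ebe ega.
apply: (@not_NL_free _ _ la).
apply: le_trans (NL_ge _ _ _ (s := [:: (box_part, rmbox mu b.-1, rmbox nu d.-1)]) isT).
rewrite big_seq1 /NLterm; apply: le_trans hla _.
rewrite ler_peMl ?LR_ge0 //.
have h1 := LR_box hmu; have h2 := LR_box hnu.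
by rewrite -gtz0_ge1 lt0r mulf_neq0 // mulr_ge0 // LR_ge0.
Qed.

Lemma small_partition (mu : intpart) : (psize mu <= 1)%N ->
  is_single_box mu \/ is_empty mu.
Proof.
move=> h; have s1 := leq_trans (size_leq_psize mu) h.
have /andP[_ n0] : is_partition mu by case: mu {h s1}.
move: h s1 n0; rewrite /is_single_box /is_empty /psize.
case: (parts mu) => [|x [|y l]] //=; first by right.
by rewrite addn0 inE => x1 _ x0; left; congr (_ :: _); lia.
Qed.

Lemma psize_small (mu : intpart) : is_single_box mu \/ is_empty mu -> (psize mu <= 1)%N.
Proof. by rewrite /psize => -[->|->]. Qed.

Lemma thin_row (mu : intpart) : is_single_row mu -> thin mu.
Proof. by move=> [k e]; left; rewrite e. Qed.

Lemma thin_column (mu : intpart) : is_single_column mu -> thin mu.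
Proof. by move=> [k e]; right; rewrite /rowlen e nth_nseq; case: ifP. Qed.

Lemma rectangle_cases (mu : intpart) : is_rectangle mu ->
  [\/ is_empty mu, is_single_row mu, is_single_column mu |
   exists a b, [/\ 1 < a, 1 < b & parts mu = nseq b a]%N].
Proof.
move=> [a [b e]]; have /andP[_ n0] : is_partition mu by case: mu {e}.
case: b e => [|[|b]] e; first by constructor 1.
  by constructor 2; exists a.
case: a e => [|[|a]] e; first by rewrite e in n0.
  by constructor 3; exists b.+2.
by constructor 4; exists a.+2, b.+2.
Qed.

Theorem theorem6p1 (mu nu : intpart) :
  NL_multiplicity_free mu nu <->
    ((is_single_box mu \/ is_empty mu) \/ (is_single_box nu \/ is_empty nu))
    \/ ((is_single_row mu /\ is_rectangle nu)
        \/ (is_single_row nu /\ is_rectangle mu))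
    \/ ((is_single_column mu /\ is_rectangle nu)
        \/ (is_single_column nu /\ is_rectangle mu)).
Proof.
split=> [free|]; last first.
  case=> [[/psize_small h|/psize_small h]|[[[h r]|[h r]]|[[h r]|[h r]]]].
  - exact: small_free.
  - exact/NL_multiplicity_free_sym/small_free.
  - exact: thin_rectangle_free (thin_row h) r.
  - exact/NL_multiplicity_free_sym/(thin_rectangle_free (thin_row h) r).
  - exact: thin_rectangle_free (thin_column h) r.
  - exact/NL_multiplicity_free_sym/(thin_rectangle_free (thin_column h) r).
case: (leqP (psize mu) 1) => [/small_partition|pmu]; first by left; left.
case: (leqP (psize nu) 1) => [/small_partition|pnu]; first by left; right.
case: (pselect (is_rectangle mu)) => [rmu|nr]; last first.
  by case: (non_rectangle_not_free nr pnu free).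
case: (pselect (is_rectangle nu)) => [rnu|nr]; last first.
  by case: (non_rectangle_not_free nr pmu (NL_multiplicity_free_sym free)).
right; have [emu|h|h|[a [b [a2 b2 emu]]]] := rectangle_cases rmu.
- by have := psize_small (or_intror emu); rewrite leqNgt pmu.
- by left; left.
- by right; left.
have [enu|h|h|[c [d [c2 d2 enu]]]] := rectangle_cases rnu.
- by have := psize_small (or_intror enu); rewrite leqNgt pnu.
- by left; right.
- by right; right.
by case: (rectangles_not_free a2 b2 c2 d2 emu enu free).
Qed.
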